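(* Let $n\ge1$ and let $\mathrm{Cat}^\omega_n\subseteq\mathrm{Slide}^\omega(1,1,\ldots,1)$ ($n$ ones) be the subset of trivalent trees that are caterpillars. For each tree $T\in\mathrm{Cat}^\omega_n$, define the word $w(T)$ by reading the labels in the slide labeling of $T$ from left to right. Then the set of words $\{w(T):T\in\mathrm{Cat}^\omega_n\}$ is precisely the set of $23$-$1$-avoiding permutations of length $n$, and the words $w(T)$, $T\in\mathrm{Cat}^\omega_n$, are all distinct.
   Context: A stable tree on a leaf set $L$ is a tree whose leaves are bijectively labeled by $L$, with no vertex of degree $2$ and at least one vertex of degree $\ge 3$ (trees are considered up to label-preserving isomorphism); it is trivalent if all internal (non-leaf) vertices have degree $3$. A tree is a caterpillar if its internal vertices form a path. An internal edge is an edge joining two internal vertices. Labels are ordered $a<b<c<1<\cdots<n$. Caterpillars in $\mathrm{Slide}^\omega(1,\ldots,1)$ are drawn with the leaves $a,b$ (attached to a common end vertex of the path) on the left; ''left to right'' means moving along the path away from $a$. Slides. Let $T$ be a stable tree with leaves labeled by $a,b,c$ and some positive integers, and let $i\ge 1$ be a numbered leaf of $T$. Let $v_i$ be the internal vertex adjacent to leaf $i$. The branches of $T$ at $i$ are the connected components of $T\setminus\{v_i\}$ other than the leaf $i$; the root of a branch is its vertex adjacent to $v_i$. Let $\mathrm{Br}_a$ be the branch containing $a$, $e_a$ the edge joining $\mathrm{Br}_a$ to $v_i$, $m$ the minimal leaf label of $T\setminus(\mathrm{Br}_a\cup\{i\})$, and $\mathrm{Br}_m$ the branch containing $m$. An $i$-slide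 on $T$: add a vertex $\overline{v}$ in the middle of $e_a$, move $\mathrm{Br}_m$ so that its root is attached to $\overline{v}$, and attach each remaining branch (other than $\mathrm{Br}_a$, $\mathrm{Br}_m$) to either $v_i$ or $\overline{v}$. $\mathrm{slide}_i(T)$ is the set of stable trees so obtained (stability forces at least one branch to remain at $v_i$; so $\mathrm{slide}_i(T)=\emptyset$ if $\deg v_i=3$). For a set $\mathbf{T}$ of trees, $\mathrm{slide}_i(\mathbf{T})=\bigcup_{T\in\mathbf{T}}\mathrm{slide}_i(T)$. $\mathrm{Slide}^\omega(\mathbf{k})$, for $\mathbf{k}=(k_1,\ldots,k_n)$: start with the tree with a single internal vertex and leaves $a,b,c$; for $i=1,\ldots,n$ in order, first replace the current set of trees by the set of all trees obtained by attaching a new leaf $i$ to an existing internal vertex, then apply $\mathrm{slide}_i$ successively $k_i$ times. Slide labeling. For $T\in\mathrm{Slide}^\omega(1,\ldots,1)$, the slide labeling of $T$ is the labeling of the $n$ internal edges of $T$ by $1,\ldots,n$ formed as follows. For $\ell=n,n-1,\ldots,1$ in order: let $T'$ be the tree formed by contracting all already labeled internal edges of $T$; in $T'$ let $v_\ell$ be the internal vertex adjacent to leaf $\ell$, let $e$ be the first edge on the path from $v_\ell$ to $a$, and let $\overline{v}$ be the other vertex of $e$. Let $m_{v_\ell}$ (resp. $m_{\overline{v}}$) be the smallest label on any branch from $v_\ell$ (resp. $\overline{v}$) not containing $a$ or $\ell$. The conditions $\overline{v}\ne a$ and $\ell>m_{v_\ell}>m_{\overline{v}}$ are required (they characterize membership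 of a trivalent tree in $\mathrm{Slide}^\omega(1,\ldots,1)$); label $e$ by $\ell$. A permutation $\pi=\pi_1\cdots\pi_n$ avoids the pattern $23$-$1$ if there do not exist indices $i$ and $j$ with $i+1<j$ such that $\pi_j<\pi_i<\pi_{i+1}$. *)

(* Defs.v *)
From mathcomp Require Import all_boot.

Set Implicit Arguments.
Unset Strict Implicit.
Unset Printing Implicit Defensive.

(* Leaf labels are natural numbers with the usual order: 0, 1, 2 stand for
   a, b, c and i + 2 stands for the numbered leaf i >= 1, so that
   a < b < c < 1 < 2 < ...                                                    *)
Definition la : nat := 0.
Definition lb : nat := 1.
Definition lc : nat := 2.
Definition num (i : nat) : nat := i + 2.

(* Finite graphs some of whose vertices carry a leaf label; the axioms making
   them stable trees are in [stable_tree].                                    *)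
Record lgraph := LGraph {
  vert :> finType;
  adj : rel vert;
  lab : vert -> option nat
}.

Section Graphs.
Variable T : lgraph.
Implicit Types (v r x : T) (X : {set T}) (l : nat).

Definition degree v : nat := #|[set x | adj v x]|.
Definition internal v : bool := degree v != 1.

Definition is_tree : Prop :=
  [/\ symmetric (@adj T), irreflexive (@adj T),
      forall x y : T, connect (@adj T) x y
    & forall p : seq T, ucycle (@adj T) p -> size p <= 2].

Definition labels X : seq nat := pmap (@lab T) (enum X).

(* 0 if X carries no label *)
Definition min_label X : nat := head 0 (sort leq (labels X)).

Definition stable_tree : Prop :=
  [/\ is_tree,
      forall x, isSome (lab x) = (degree x == 1),
      uniq (labels [set: T]),
      forall x, degree x != 2
    & exists x, 3 <= degree x].

Definition trivalent : Prop := forall v, internal v -> degree v = 3.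

Definition is_internal_path (p : seq T) : bool :=
  [&& sorted (@adj T) p, uniq p & [forall v, (v \in p) == internal v]].

Definition caterpillar : Prop := exists p : seq T, is_internal_path p.

Definition at_leaf l v : bool := [exists x, (lab x == Some l) && adj x v].

(* The connected component of T \ {v} containing r; it is a branch at v, with
   root r, when r is adjacent to v.                                           *)
Definition branch v r : {set T} :=
  [set x | connect [rel y z | [&& adj y z, y != v & z != v]] r x].

(* r is the root of the branch at v containing the leaf labeled l *)
Definition root_toward v l r : bool :=
  adj v r && (l \in labels (branch v r)).

End Graphs.

Definition iso (T U : lgraph) : Prop :=
  exists f : T -> U,
    [/\ bijective f, forall x y, adj (f x) (f y) = adj x y
      & forall x, lab (f x) = lab x].

Definition star_abc : lgraph :=
  @LGraph (option 'I_3)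
    (fun x y => isSome x != isSome y)
    (fun x => if x is Some l then Some (l : nat) else None).

(* The new vertex None is a leaf labeled l attached to v. *)
Definition attach_at (T : lgraph) (l : nat) (v : T) : lgraph :=
  @LGraph (option T)
    (fun x y => match x, y with
                | Some x, Some y => adj x y
                | Some x, None | None, Some x => x == v
                | None, None => false
                end)
    (fun x => if x is Some x then lab x else Some l).

(* The new vertex None is joined to v, and the branches at v with roots in M
   are detached from v and attached to it.                                    *)
Definition move_branches (T : lgraph) (v : T) (M : {set T}) : lgraph :=
  @LGraph (option T)
    (fun x y => match x, y with
                | Some x, Some y =>
                    [&& adj x y, ~~ ((x == v) && (y \in M))
                      & ~~ ((y == v) && (x \in M))]
                | Some x, None | None, Some x => (x == v) || (x \in M)
                | None, None => false
                end)
    (fun x => if x is Some x then lab x else None).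

(* Membership of T' in slide_i(T).  The set M consists of the roots of the
   branches that end up at the new vertex: those of Br_a (so that the new
   vertex subdivides e_a), of Br_m, and of an arbitrary set of other branches
   different from the leaf i.                                                 *)
Definition slide (i : nat) (T T' : lgraph) : Prop :=
  exists (li v ra rm : T) (M : {set T}),
    [/\ lab li = Some (num i) /\ adj li v,
        root_toward v la ra,
        root_toward v (min_label (~: (branch v ra :|: [set li]))) rm,
        [/\ M \subset [set x | adj v x] :\ li, ra \in M & rm \in M]
      & stable_tree (move_branches v M) /\ iso T' (move_branches v M)].

(* Sets of trees up to isomorphism are isomorphism-invariant predicates. *)
Definition slide_set (i : nat) (X : lgraph -> Prop) : lgraph -> Prop :=
  fun T' => exists2 T, X T & slide i T T'.

Definition attach_set (i : nat) (X : lgraph -> Prop) : lgraph -> Prop :=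
  fun T' => exists2 T, X T &
    exists2 v : T, internal v & iso T' (attach_at (num i) v).

Fixpoint slide_from (i : nat) (ks : seq nat) (X : lgraph -> Prop) :
    lgraph -> Prop :=
  if ks is k :: ks' then
    slide_from i.+1 ks' (iter k (slide_set i) (attach_set i X))
  else X.

Definition SlideOmega (ks : seq nat) : lgraph -> Prop :=
  slide_from 1 ks (fun T => iso T star_abc).

Section SlideLabeling.
Variable T : lgraph.

(* Edges of T are represented by the sets of their two endpoints. *)
Definition contraction_classes (F : {set {set T}}) : {set {set T}} :=
  equivalence_partition
    (connect [rel x y | adj x y && ([set x; y] \in F)]) [set: T].

(* The graph obtained by contracting the edges in F: its vertices are the
   classes of vertices of T that get identified.                              *)
Definition contract (F : {set {set T}}) : lgraph :=
  @LGraph {A : {set T} | A \in contraction_classes F}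
    (fun A B => (A != B) && [exists x in val A, exists y in val B, adj x y])
    (fun A => obind (@lab T) [pick x in val A | isSome (lab x)]).

End SlideLabeling.

(* The smallest label on a branch from v containing neither a nor the leaf
   labeled l.                                                                 *)
Definition min_off (T : lgraph) (l : nat) (v : T) : nat :=
  min_label (\bigcup_(r | adj v r && (la \notin labels (branch v r))
                                  && (l \notin labels (branch v r)))
               branch v r).

(* (v, vb) is (v_l, \overline{v}) in the contracted tree T', the edge to be
   labeled l being the one joining v to vb; the three conditions of the slide
   labeling are part of the definition.                                       *)
Definition slide_edge (T' : lgraph) (l : nat) (v vb : T') : bool :=
  [&& at_leaf (num l) v, root_toward v la vb, lab vb != Some la,
      min_off (num l) v < num l & min_off (num l) vb < min_off (num l) v].

(* A partial labeling of the edges of T has value 0 on the edges that are not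
   yet labeled.  The edge of T' found above comes from the edge [set p.1; p.2]
   of T.                                                                      *)
Definition label_step (T : lgraph) (l : nat) (lam : {set T} -> nat) :
    {set T} -> nat :=
  let T' := contract [set e | lam e != 0] in
  if [pick p : T * T | adj p.1 p.2 &&
        [exists v : T', exists vb : T',
           [&& slide_edge l v vb, p.1 \in val v & p.2 \in val vb]]]
  is Some p
  then fun e => if e == [set p.1; p.2] then l else lam e
  else lam.

(* foldr treats the labels in the order n, n - 1, ..., 1. *)
Definition slide_labeling (n : nat) (T : lgraph) : {set T} -> nat :=
  foldr (@label_step T) (fun _ => 0) (iota 1 n).

(* The internal vertices of a caterpillar from left to right, starting at the
   one adjacent to a.                                                         *)
Definition spine (T : lgraph) : seq T :=
  if [pick p : #|[set v : T | internal v]|.-tuple T |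
        is_internal_path p && (if tval p is x :: _ then at_leaf la x else false)]
  is Some p then tval p else [::].

Definition word (n : nat) (T : lgraph) : seq nat :=
  if spine T is x :: p
  then pairmap (fun y z => slide_labeling n [set y; z]) x p
  else [::].

Definition Cat (n : nat) (T : lgraph) : Prop :=
  [/\ SlideOmega (nseq n 1) T, trivalent T & caterpillar T].

Definition avoids_23_1 (s : seq nat) : Prop :=
  ~ exists i j, [/\ i.+1 < j, j < size s, nth 0 s j < nth 0 s i
                  & nth 0 s i < nth 0 s i.+1].

(* Main.v *)
Require Import Defs.
From mathcomp Require Import all_boot zify.

Set Implicit Arguments.
Unset Strict Implicit.
Unset Printing Implicit Defensive.

(** All trees of Slide(1, ..., 1) have internal vertices of degree 3, and the
    step [i] has a simple effect: leaf [i] is attached to a vertex [v] with branches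
    A (containing [a]), B and C, where B has a smaller least label than C, and the
    slide moves A and B to a new vertex, so that [i] ends up planted in the middle of
    the edge from [v] to C.

    Suppose that the result is a caterpillar. Then so was the tree before the
    step, since merging the new vertex and [v] turns its spine into a spine of
    that tree ([move_spine_path], [attach_spine_path]). If B were not a leaf, the
    new vertex would have three internal neighbours, so B is a leaf; conversely,
    if B is a leaf then the step keeps the tree a caterpillar ([slide_layout],
    [slide_exists]). A caterpillar is described, up to isomorphism, by the function
    [P] that sends each leaf to the position along the spine of the vertex it
    hangs from ([layout], [layout_unique]). Step [i] at position [j] of the spine
    modifies [P] into [graft], and inserts the new edge [i] at index [j] into the word
    of the edge labels, as the edge to the right of [v] now starts at a later
    vertex. The relation [grown n w P] says that [P] and [w] arise by [n] such steps;
    [SlideOmega_layout] and [layout_SlideOmega] relate it to the trees.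

    Which words grow? The position [j] allows a step iff the least label other than
    [a] located at or after [j] hangs at [j]. An induction shows that for
    [0 < j] this holds iff the letter of [w] before index [j] is a right-to-left
    minimum ([grown_admissible]). But inserting a new largest letter after a given letter
    creates a 23-1 exactly if that letter is not a right-to-left minimum, and
    removing the largest letter never creates one ([avoids_insert_at]). So the words
    that grow are the permutations avoiding 23-1 ([grown_avoids], [avoids_grown]). The
    place of the largest letter of [w] tells where the last step was made, so [w]
    determines [P] and hence the tree ([grown_uniq]).

    It remains to see that the slide labeling really gives each edge the number of
    the step that created it ([wordE]). Contracting the edges labeled above [l] yields
    a layout again ([contract_layout]), in which the old leaves are back at the
    positions that they had after step [l] and the leaves above [l], although
    present, are too large to matter ([grown_stage]). There the conditions defining the edge
    labeled [l] single out the edge between the two vertices into which step [l]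
    split one, both with respect to existence and to uniqueness
    ([slide_edge_intro], [slide_edge_elim], [label_step_above]). *)

(** * Inserting a letter into a word *)

Definition insert_at (j a : nat) (w : seq nat) : seq nat :=
  take j w ++ a :: drop j w.

Lemma nth_insert_at j a w i : j <= size w ->
  nth 0 (insert_at j a w) i =
  if i < j then nth 0 w i else if i == j then a else nth 0 w i.-1.
Proof.
move=> jw; rewrite /insert_at nth_cat size_take_min (minn_idPl jw).
case: ltngtP => [ij|ji|->]; first by rewrite nth_take.
  have -> : i - j = (i - j).-1.+1 by lia.
  by rewrite /= nth_drop; congr nth; lia.
by rewrite subnn.
Qed.

Lemma size_insert_at j a w : size (insert_at j a w) = (size w).+1.
Proof. by rewrite size_cat /= addnS -size_cat cat_take_drop. Qed.

Lemma perm_insert_at j a w : perm_eq (insert_at j a w) (a :: w).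
Proof. by rewrite perm_catC /= perm_cons perm_catC cat_take_drop. Qed.

Lemma index_insert_at j a w :
  j <= size w -> a \notin w -> index a (insert_at j a w) = j.
Proof.
move=> jw aw; rewrite index_cat ifN /= ?eqxx ?addn0 ?size_takel //.
by apply: contra aw; apply: mem_take.
Qed.

Lemma insert_at_inj j1 j2 a w1 w2 : j1 <= size w1 -> j2 <= size w2 ->
    a \notin w1 -> a \notin w2 -> insert_at j1 a w1 = insert_at j2 a w2 ->
  j1 = j2 /\ w1 = w2.
Proof.
move=> s1 s2 a1 a2 e; have ej : j1 = j2.
  by rewrite -(index_insert_at s1 a1) e index_insert_at.
split=> //; subst j2; move: e => /eqP; rewrite /insert_at eqseq_cat.
  by case/andP=> /eqP e1 /eqP [e2]; rewrite -(cat_take_drop j1 w1) e1 e2 cat_take_drop.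
by rewrite !size_takel.
Qed.

Lemma count_take_insert_lo (p : pred nat) j a w k : k <= j ->
  j <= size w ->
  count p (take k (insert_at j a w)) = count p (take k w).
Proof.
move=> kj jw; congr count; rewrite /insert_at takel_cat ?size_takel //.
by rewrite take_takel.
Qed.

Lemma count_take_insert_hi (p : pred nat) j a w k : j <= k -> j <= size w ->
  ~~ p a -> count p (take k.+1 (insert_at j a w)) = count p (take k w).
Proof.
move=> jk jw pa; rewrite /insert_at take_cat size_takel // ltnNge leqW //=.
rewrite subSn //= count_cat /= (negbTE pa) add0n -count_cat; congr count.
by rewrite -{3}(cat_take_drop j w) take_cat size_takel // ltnNge jk.
Qed.

(** * Growing a caterpillar one leaf at a time *)

Definition attach_pos (N : nat) (P : nat -> nat) (j : nat) : nat -> nat :=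
  fun x => if x == N then j else P x.

(** Effect of splitting the spine vertex at [j] in two. The new vertex takes the
    position [j], and everything from [j] on moves one step to the right, except
    the leaf [q], which is the branch that accompanies the one of [a], and [a]
    itself when [j = 0]. *)
Definition shift_pos (P : nat -> nat) (j q : nat) : nat -> nat :=
  fun x => P x + [&& j <= P x, x != 0 & x != q].

Definition graft (N : nat) (P : nat -> nat) (j q : nat) : nat -> nat :=
  shift_pos (attach_pos N P j) j q.

(** A slide at position [j] keeps the tree a caterpillar iff the branch of
    smaller minimum at [j] is a leaf, not the right part of the spine: the
    least label [q <> a] located at or after [j] has to sit at [j]. *)
Definition admissible (N : nat) (P : nat -> nat) (j q : nat) : Prop :=
  [/\ 0 < q < N, P q = j & forall y, 0 < y < N -> j <= P y -> q <= y].

(** [grown n w P]: some caterpillar with [n] internal edges is obtained by [n]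
    legal steps, [w] is the word of its edge labels and [P] gives the position
    of the vertex of each leaf. Splitting the vertex at [j] creates the edge
    [n.+1] to the left of all the edges at or after [j], whence the insertion
    at index [j] of the word. *)
Inductive grown : nat -> seq nat -> (nat -> nat) -> Prop :=
| Grown0 : grown 0 [::] (fun=> 0)
| GrownS n w P j q : grown n w P -> j <= n -> admissible n.+3 P j q ->
    grown n.+1 (insert_at j n.+1 w) (graft n.+3 P j q).

(** The positions of the leaves when all spine vertices have degree 3: besides
    [a], which is at position 0, there is one leaf at each position before
    the last one, and there are two at the last one. *)
Record trivalent_pos (n : nat) (P : nat -> nat) : Prop := TrivalentPos {
  pos_a : P 0 = 0;
  pos_b : P 1 = 0;
  pos_max : forall x, x < n.+3 -> P x <= n;
  one_ex : forall j, j < n -> exists2 x, 0 < x < n.+3 & P x = j;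
  one_uniq : forall x y, 0 < x < n.+3 -> 0 < y < n.+3 ->
    P x = P y -> P x < n -> x = y;
  two_ex : exists x y, [/\ 0 < x < n.+3, 0 < y < n.+3, x != y, P x = n & P y = n];
  two_max : forall x y z, 0 < x < n.+3 -> 0 < y < n.+3 -> 0 < z < n.+3 ->
    P x = n -> P y = n -> P z = n -> [|| x == y, y == z | x == z]
}.

Lemma graft_new N P j q : 0 < q < N -> graft N P j q N = j.+1.
Proof.
rewrite /graft /shift_pos /attach_pos eqxx leqnn /=.
by case: N => [|N]; case: (_ =P q); lia.
Qed.

Lemma graft_min N P j q : 0 < q < N -> P q = j -> graft N P j q q = j.
Proof.
by move=> qN <-; rewrite /graft /shift_pos /attach_pos eqxx !andbF addn0 ifN //; lia.
Qed.

Lemma graft_old N P j q x : 0 < x < N -> x != q ->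
  graft N P j q x = P x + (j <= P x).
Proof.
move=> xN xq; rewrite /graft /shift_pos /attach_pos ifN; last by lia.
by case/andP: xN; rewrite xq andbT lt0n => ->; rewrite andbT.
Qed.

Lemma graft_trivalent n P j q : trivalent_pos n P -> j <= n ->
  admissible n.+3 P j q -> trivalent_pos n.+1 (graft n.+3 P j q).
Proof.
move=> [Pa Pb Pm oe ou [x0 [y0 [xl yl xy Px Py]]] tm] jn [ql Pq qm].
have j0q : j = 0 -> q = 1.
  by move=> j0; have := qm 1 isT; rewrite Pb j0 => /(_ isT); lia.
have grN : graft n.+3 P j q n.+3 = j.+1 by apply: graft_new.
have grq : graft n.+3 P j q q = j by apply: graft_min.
have grE x : 0 < x < n.+3 -> x != q ->
    graft n.+3 P j q x = P x + (j <= P x) by apply: graft_old.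
have grC x : 0 < x < n.+4 -> x = n.+3 /\ graft n.+3 P j q x = j.+1 \/
   [/\ x < n.+3, x = q & graft n.+3 P j q x = j] \/
   [/\ x < n.+3, x <> q & graft n.+3 P j q x = P x + (j <= P x)].
  move=> xb; have [->|xN] := eqVneq x n.+3; first by left.
  right; have [->|xq] := eqVneq x q; [left | right].
    by split=> //; case/andP: ql.
  by split; [lia | apply/eqP | apply: grE => //; lia].
have shared u v : 0 < u < n.+3 -> 0 < v < n.+3 -> P u = P v -> u <> v -> P u = n.
  move=> ub vb e nuv; have := ou u v ub vb e; have := Pm u ltac:(lia).
  by move: nuv; clear; lia.
split.
- by rewrite /graft /shift_pos /attach_pos /= Pa andbF.
- rewrite /graft /shift_pos /attach_pos /= Pb leqn0; case: eqP => //= j0.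
  by rewrite (j0q j0).
- move=> x xl'; rewrite /graft /shift_pos /attach_pos; case: eqVneq => /= xN.
    by rewrite -addn1 leq_add // leq_b1.
  by rewrite -addn1 leq_add ?leq_b1 // Pm //; lia.
- move=> k kn; have [kj|] := ltnP k j.
    have [x xb Px'] := oe k ltac:(lia).
    exists x; [lia | rewrite grE //]; first by rewrite Px'; lia.
    by apply/eqP => xq; move: Pq; rewrite -xq Px'; lia.
  rewrite leq_eqVlt => /orP [/eqP <-|jk]; first by exists q => //; lia.
  have [->|kj] := eqVneq k j.+1; first by exists n.+3 => //; lia.
  have [x xb Px'] := oe k.-1 ltac:(lia).
  exists x; [lia | rewrite grE ?Px' //]; first by lia.
  by apply/eqP => xq; move: Pq; rewrite -xq Px'; lia.
- move=> x y xb yb.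
  case: (grC x xb) => [[ex ->]|[[xl' ex ->]|[xl' ex ->]]];
  case: (grC y yb) => [[ey ->]|[[yl' ey ->]|[yl' ey ->]]]; rewrite ?ex ?ey //.
  + by clear; lia.
  + by move: (shared y q ltac:(lia) ltac:(lia)) Pq ey; clear; lia.
  + by clear; lia.
  + by move: ex Pq; clear; lia.
  + by move: (shared x q ltac:(lia) ltac:(lia)) Pq ex; clear; lia.
  + by move: ey Pq; clear; lia.
  + by move: (shared x y ltac:(lia) ltac:(lia)) jn; clear; lia.
- have [ej|jn'] := eqVneq j n.
    have [ex|ex] := eqVneq x0 q.
      exists y0, n.+3; split=> //; [lia|lia|lia| |lia].
      rewrite grE //; first by lia.
      by rewrite -ex eq_sym.
    by exists x0, n.+3; split=> //; [lia|lia|lia| rewrite grE //; lia|lia].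
  exists x0, y0; split=> //; [lia|lia| |].
    by rewrite grE //; [lia | apply/eqP => e; move: Pq; rewrite -e; lia].
  by rewrite grE //; [lia | apply/eqP => e; move: Pq; rewrite -e; lia].
- move=> x y z xb yb zb.
  case: (grC x xb) => [[ex ->]|[[xl' ex ->]|[xl' ex ->]]];
  case: (grC y yb) => [[ey ->]|[[yl' ey ->]|[yl' ey ->]]];
  case: (grC z zb) => [[ez ->]|[[zl' ez ->]|[zl' ez ->]]];
  rewrite ?ex ?ey ?ez ?eqxx ?orbT //; try by move: jn; clear; lia.
  + move: (tm y z q ltac:(lia) ltac:(lia) ltac:(lia)) Pq jn ey ez; clear; lia.
  + move: (tm x z q ltac:(lia) ltac:(lia) ltac:(lia)) Pq jn ex ez; clear; lia.
  + move: (tm x y q ltac:(lia) ltac:(lia) ltac:(lia)) Pq jn ex ey; clear; lia.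
  + move: (tm x y z ltac:(lia) ltac:(lia) ltac:(lia)) Pq jn ex ey ez; clear; lia.
Qed.

Lemma grown_trivalent n w P : grown n w P -> trivalent_pos n P.
Proof.
elim=> [|m v Q j q _ tP jn ad]; last exact: graft_trivalent.
split=> //; first by exists 1, 2.
by move=> [|[|[|?]]] [|[|[|?]]] [|[|[|?]]].
Qed.

Lemma grown_perm n w P : grown n w P -> perm_eq w (iota 1 n).
Proof.
elim=> [|m v Q j q _ IH _ _] //.
rewrite -[in iota 1 m.+1](addn1 m) iotaD add1n cats1.
by rewrite (permPl (perm_insert_at _ _ _)) perm_sym perm_rcons perm_cons perm_sym.
Qed.

Lemma grown_size n w P : grown n w P -> size w = n.
Proof. by move/grown_perm/perm_size; rewrite size_iota. Qed.

Lemma perm_mem_le n (w : seq nat) x : perm_eq w (iota 1 n) -> (x \in w) = (0 < x <= n).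
Proof. by move/perm_mem->; rewrite mem_iota; lia. Qed.

Lemma perm_nth n (w : seq nat) k : perm_eq w (iota 1 n) -> k < n -> 0 < nth 0 w k <= n.
Proof.
move=> pw kn; rewrite -(perm_mem_le _ pw) mem_nth //.
by rewrite (perm_size pw) size_iota.
Qed.

Lemma grown_inv n w P : grown n.+1 w P -> exists w0 P0 j q,
  [/\ grown n w0 P0, j <= n, admissible n.+3 P0 j q,
      w = insert_at j n.+1 w0 & P = graft n.+3 P0 j q].
Proof. by move=> g; inversion g as [|m v Q j q]; exists v, Q, j, q. Qed.

(** The index of the largest letter of [w] says where the last step took place,
    and the moved leaf [q] is determined by the positions before that step. *)
Lemma grown_uniq n w P P' : grown n w P -> grown n w P' ->
  forall x, x < n.+3 -> P x = P' x.
Proof.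
elim: n w P P' => [|n IH] w P P'; first by move=> g g'; inversion g; inversion g'.
move=> /grown_inv [v [Q [j [q [g jn [qb Pq qm] ew ->]]]]].
move=> /grown_inv [v' [Q' [j' [q' [g' jn' [qb' Pq' qm'] ew' ->]]]]] x xl.
have := ew'; rewrite ew => /insert_at_inj [].
- by rewrite (grown_size g).
- by rewrite (grown_size g').
- by rewrite (perm_mem_le _ (grown_perm g)) ltnn andbF.
- by rewrite (perm_mem_le _ (grown_perm g')) ltnn andbF.
move=> ej' ev; subst j' v'.
have PP := IH _ _ _ g g'.
have -> : q = q'.
  have qq' : q <= q' by apply: qm => //; rewrite PP; lia.
  have q'q : q' <= q by apply: qm' => //; rewrite -(PP q); lia.
  by lia.
by rewrite /graft /shift_pos /attach_pos -ej'; case: eqVneq => // xN; rewrite PP //; lia.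
Qed.

(** * Legal steps and the pattern 23-1 *)

(** [j] is the index at which a letter inserted just after the minimum ends up,
    hence the predecessor. *)
Definition rlmin (w : seq nat) (j : nat) : Prop :=
  forall k, j <= k < size w -> nth 0 w j.-1 <= nth 0 w k.

Lemma rlmin_insert_lo n w j i : perm_eq w (iota 1 n) -> j <= n -> 0 < i <= j ->
  rlmin (insert_at j n.+1 w) i <-> rlmin w i.
Proof.
move=> pw jn ij; have sw : size w = n by rewrite (perm_size pw) size_iota.
rewrite /rlmin size_insert_at sw; split=> h k kb.
  have [kj|jk] := ltnP k j.
    have := h k ltac:(lia); rewrite !nth_insert_at ?sw // kj ifT //; lia.
  have := h k.+1 ltac:(lia); rewrite !nth_insert_at ?sw //.
  by rewrite ifT ?ifN //; lia.
have pi := perm_nth pw (k := i.-1) ltac:(lia).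
rewrite !nth_insert_at ?sw // ifT; last by lia.
case: ltngtP => kj; [apply: h | apply: h | ]; lia.
Qed.

Lemma rlmin_insert_hi n w j i : perm_eq w (iota 1 n) -> j <= n -> j < i.-1 ->
  rlmin (insert_at j n.+1 w) i <-> rlmin w i.-1.
Proof.
move=> pw jn ij; have sw : size w = n by rewrite (perm_size pw) size_iota.
rewrite /rlmin size_insert_at sw; split=> h k kb.
  have := h k.+1 ltac:(lia); rewrite !nth_insert_at ?sw //.
  by rewrite !ifN //; lia.
rewrite !nth_insert_at ?sw // !ifN; try lia.
by apply: h; lia.
Qed.

(** The two sequences of leaves and of edges grow in parallel. A step at [j0]
    does not affect the right-to-left minima at other places; at the new place
    [j0.+1] both properties fail, as something smaller than the new largest
    label lies further right, unless the step took place at the right end, where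
    both hold trivially. *)
Lemma grown_admissible n w P : grown n w P -> forall j, 0 < j <= n ->
  (exists q, admissible n.+3 P j q) <-> rlmin w j.
Proof.
elim: n w P => [|n IH] w P; first by move=> _ j; lia.
move=> gg; have tP := grown_trivalent gg; case/grown_inv: (gg).
move=> w0 [P0 [j0 [q0 [g0 jn0 [qb0 Pq0 qm0] ew eP]]]] j jb.
have pw0 := grown_perm g0; have tP0 := grown_trivalent g0.
have sw0 := grown_size g0.
have [x0 [y0 [xb yb xy Px Py]]] := two_ex tP0.
have PN : P n.+3 = j0.+1 by rewrite eP graft_new.
have Pq : P q0 = j0 by rewrite eP graft_min.
have Pold x : 0 < x < n.+3 -> x <> q0 -> P x = P0 x + (j0 <= P0 x).
  by move=> xb' /eqP xq; rewrite eP graft_old.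
have [ij|] := leqP j j0.
  rewrite ew (rlmin_insert_lo pw0) //; last by lia.
  rewrite -(IH _ _ g0); last by lia.
  (* for j = j0 it is q0 that makes the position legal afterwards *)
  split=> -[q [qb Pqj qm]]; [exists q | exists (if j == j0 then q0 else q)].
    have qN : q <> n.+3 by move=> e; move: Pqj; rewrite e PN; lia.
    have P0q : P0 q = j.
      have [e|/eqP qq] := eqVneq q q0; first by move: Pqj; rewrite e Pq; lia.
      by have := Pold q ltac:(lia) qq; lia.
    split=> //; first by lia.
    move=> y yb' jy; apply: qm; first by lia.
    have [->|/eqP yq] := eqVneq y q0; first by rewrite Pq.
    by rewrite Pold //; lia.
  case: eqVneq => jj0.
    split; [lia|lia|] => y yb' jy.
    have [yN|] := eqVneq y n.+3; first by lia.
    have [->|/eqP yq] := eqVneq y q0; first by [].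
    by move=> yN; apply: qm0; [lia | move: jy; rewrite Pold //; lia].
  have qq : q <> q0 by move=> e; move: Pqj; rewrite e Pq0; lia.
  split; [lia | rewrite Pold //; lia |] => y yb' jy.
  have [yN|] := eqVneq y n.+3; first by lia.
  have [->|/eqP yq] := eqVneq y q0; first by move=> _; apply: qm; lia.
  by move=> yN; apply: qm; [lia | move: jy; rewrite Pold //; lia].
have [->|jn1] := eqVneq j j0.+1 => [_|].
  have [en|jn0'] := eqVneq j0 n.
    split=> _; first by move=> k; rewrite ew size_insert_at sw0; lia.
    have x1 : exists q, [&& 0 < q < n.+3, P0 q == n & q != q0].
      by have [e|e] := eqVneq x0 q0; [exists y0 | exists x0]; lia.
    case: (ex_minnP x1) => q /and3P [qb /eqP Pqn /eqP qq] qm; exists q; split.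
    - lia.
    - by rewrite Pold //; lia.
    move=> y yb'; have [yN|yN] := eqVneq y n.+3; first by lia.
    have [->|/eqP yq] := eqVneq y q0; first by rewrite Pq; lia.
    by rewrite Pold //; have := pos_max tP0 (x := y); have := qm y; lia.
  split=> [[q [qb Pqj qm]]|h].
    have xq : x0 <> q0 by move=> e; move: Pq0; rewrite -e; lia.
    have : q <= x0 by apply: qm; [lia | rewrite Pold //; lia].
    have [e|e qx] := eqVneq q n.+3; first by lia.
    have [e'|/eqP e'] := eqVneq q q0; first by move: Pqj; rewrite e' Pq; lia.
    have := Pold q ltac:(lia) e'; rewrite Pqj => P0q.
    by have := one_uniq tP0 (x := q) (y := q0); lia.
  have := h j0.+1; rewrite ew size_insert_at sw0 /= => /(_ ltac:(lia)).
  rewrite !nth_insert_at ?sw0 // ltnn eqxx ifN ?ifN; try lia.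
  by have := perm_nth pw0 (k := j0) ltac:(lia); rewrite /=; lia.
move=> jj; rewrite ew (rlmin_insert_hi pw0) //; last by lia.
rewrite -(IH _ _ g0); last by lia.
split=> -[q [qb Pqj qm]]; exists q.
  have qN : q <> n.+3 by move=> e; move: Pqj; rewrite e PN; lia.
  have qq : q <> q0 by move=> e; move: Pqj; rewrite e Pq; lia.
  split=> //; [lia | by have := Pold q ltac:(lia) qq; lia |].
  move=> y yb' jy; apply: qm; first by lia.
  have yq : y <> q0 by move=> e; move: jy; rewrite e; lia.
  by rewrite Pold //; lia.
have qq : q <> q0 by move=> e; move: Pqj; rewrite e; lia.
split=> //; [lia | rewrite Pold //; lia |].
move=> y yb'; have [yN|yN] := eqVneq y n.+3; first by lia.
have [->|/eqP yq] := eqVneq y q0; first by rewrite Pq; lia.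
by rewrite Pold // => [jy|]; [apply: qm; lia | lia].
Qed.

(** A largest letter can only play the part of the 3. It does so with the letter
    before it as the 2, and any smaller letter further right as the 1. If its
    removal makes adjacent two letters that form the 23 of a pattern, then the
    first of them and the removed letter already did, with the same 1. *)
Lemma avoids_insert_at n w j : perm_eq w (iota 1 n) -> j <= n ->
  avoids_23_1 (insert_at j n.+1 w) <-> avoids_23_1 w /\ (0 < j -> rlmin w j).
Proof.
move=> pw jn; have sw : size w = n by rewrite (perm_size pw) size_iota.
have wn k : k < n -> nth 0 w k <= n by move=> kn; have := perm_nth pw kn; lia.
split=> [av|[av rl] [i [k [ik]]]].
  split=> [[i [k [ik kn ki ii]]]|j0 k kb].
    rewrite sw in kn; apply: av.
    exists (if j <= i then i.+1 else i), (if j <= k then k.+1 else k).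
    rewrite size_insert_at sw !nth_insert_at ?sw //.
    have := wn i ltac:(lia).
    have [ji|ij] := leqP j i.
      have jk : j <= k by lia.
      by rewrite jk !ifN /=; try lia; split; lia.
    rewrite ij; have [jk|kj] := leqP j k; last by rewrite !ifT; try lia; split; lia.
    rewrite ifN; last by lia.
    rewrite ifN; last by lia.
    by case: (ltngtP i.+1 j) => /= e; split; lia.
  rewrite sw in kb; rewrite leqNgt; apply/negP => kj; apply: av; exists j.-1, k.+1.
  rewrite size_insert_at prednK // !nth_insert_at ?sw // ltnn eqxx.
  rewrite ifN; last by lia.
  rewrite ifN; last by lia.
  rewrite ifT; last by lia.
  by have := wn j.-1 ltac:(lia); split=> //=; lia.
rewrite size_insert_at sw !nth_insert_at ?sw // => kn.
have wk := wn k.-1; have wi := wn i.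
have [e|kj] := eqVneq k j.
  by rewrite e ltnn ifT; have := wi; lia.
have [e|ij] := eqVneq i j.
  by move=> _; rewrite e ltnn !ifN /=; have := wn j; lia.
have [ei|ij'] := eqVneq i.+1 j.
  rewrite -ei ltnSn ifN; last by lia.
  move=> lt _; have := rl ltac:(lia) k.-1; rewrite sw => /(_ ltac:(lia)).
  by rewrite -ei /=; lia.
move=> h1 h2; apply: av.
exists (if j <= i then i.-1 else i), (if j <= k then k.-1 else k).
have [ji|{}ij] := leqP j i.
  have jk : j <= k by lia.
  move: h1 h2; rewrite jk !ifN /=; try lia.
  by rewrite sw prednK; [split=> //; lia | lia].
have ij1 : i.+1 < j by lia.
move: h1 h2; rewrite ij ij1.
by have [jk|{}kj] := leqP j k; rewrite sw; split=> //; lia.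
Qed.

Lemma grown_avoids n w P : grown n w P -> avoids_23_1 w.
Proof.
elim=> [|m v Q j q g IH jm ad]; first by case=> i [k []].
rewrite (avoids_insert_at (grown_perm g) jm); split=> // j0.
by apply/(grown_admissible g); [lia | exists q].
Qed.

Lemma avoids_grown n w :
  perm_eq w (iota 1 n) -> avoids_23_1 w -> exists P, grown n w P.
Proof.
elim: n w => [|n IH] w pw av.
  by move/perm_nilP: pw => ->; exists (fun=> 0); constructor.
have sw : size w = n.+1 by rewrite (perm_size pw) size_iota.
have nw : n.+1 \in w by rewrite (perm_mem_le _ pw); lia.
case/splitPr: nw pw av sw => w1 w2 pw av sw.
set v := w1 ++ w2; set j := size w1.
have ew : w1 ++ n.+1 :: w2 = insert_at j n.+1 v.
  by rewrite /insert_at take_size_cat ?drop_size_cat.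
have pv : perm_eq v (iota 1 n).
  have : perm_eq (n.+1 :: v) (n.+1 :: iota 1 n).
    rewrite -(permPl (perm_insert_at j _ _)) -ew; apply: (perm_trans pw).
    by rewrite -[in iota 1 n.+1](addn1 n) iotaD add1n cats1 perm_rcons.
  by rewrite perm_cons.
have jn : j <= n by rewrite /j; move: sw; rewrite size_cat /=; lia.
move: av; rewrite ew (avoids_insert_at pv jn) => -[/(IH _ pv) [P g] rl].
suff [q ad] : exists q, admissible n.+3 P j q by exists (graft n.+3 P j q); constructor.
have [->|j0] := posnP j; last by apply/(grown_admissible g); [lia | apply: rl].
by exists 1; split=> //; [exact: pos_b (grown_trivalent g) | lia].
Qed.

(** * The word seen after contracting the large edges *)

(** The position of the leaf [x] once the edges labeled above [l] have been
    contracted: the number of remaining edges to its left. *)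
Definition stage (w : seq nat) (P : nat -> nat) (l x : nat) : nat :=
  count (leq^~ l) (take (P x) w).

(** Contracting the edges above [l] takes the old leaves back to their positions
    just after step [l], because every later step inserts a larger letter and
    moves the leaves accordingly; the leaves above [l] are merely hung somewhere
    and never are the minimum of anything. Hence the situation around the edge
    [l] is that of the step which created it: the moved leaf [q] on its left end
    is smaller than everything to its right, and there is a leaf [r] smaller
    than leaf [l] on its right. *)
Lemma grown_stage n w P l : grown n w P -> 0 < l <= n ->
  let j := count (leq^~ l) (take (index l w) w) in
  (exists q, admissible n.+3 (stage w P l) j q) /\
  stage w P l (num l) = j.+1 /\
  (exists r, 0 < r < num l /\ j < stage w P l r).
Proof.
move=> g lb; rewrite /stage; elim: g lb => [|m v Q i q0 g IH im ad] lb; first by lia.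
have tQ := grown_trivalent g; have pv := grown_perm g; have sv := grown_size g.
have nv : m.+1 \notin v by rewrite (perm_mem_le _ pv) ltnn andbF.
have [qb Qq qm] := ad.
have [el|lm] := eqVneq l m.+1.
  have tP := graft_trivalent tQ im ad.
  have cE x : x < m.+4 ->
      count (leq^~ l) (take (graft m.+3 Q i q0 x) (insert_at i m.+1 v)) =
      graft m.+3 Q i q0 x.
    move=> xm; have := pos_max tP xm => gx.
    have -> : count (leq^~ l) (take (graft m.+3 Q i q0 x) (insert_at i m.+1 v))
      = size (take (graft m.+3 Q i q0 x) (insert_at i m.+1 v)).
      apply/eqP; rewrite -all_count; apply/allP => y /mem_take.
      by rewrite (perm_mem (perm_insert_at _ _ _)) inE (perm_mem_le _ pv); lia.
    by rewrite size_takel // size_insert_at sv.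
  have -> : count (leq^~ l) (take (index l (insert_at i m.+1 v)) (insert_at i m.+1 v)) = i.
    rewrite el index_insert_at ?sv // count_take_insert_lo ?sv //.
    have : all (leq^~ m.+1) (take i v).
      by apply/allP => y /mem_take; rewrite (perm_mem_le _ pv); lia.
    by rewrite all_count size_takel ?sv // => /eqP.
  have gq : graft m.+3 Q i q0 q0 = i by apply: graft_min.
  have gN : graft m.+3 Q i q0 m.+3 = i.+1 by apply: graft_new.
  have gE x : 0 < x < m.+3 -> x <> q0 -> graft m.+3 Q i q0 x = Q x + (i <= Q x).
    by move=> xb' /eqP xq; apply: graft_old.
  have eN : num l = m.+3 by rewrite /num el; lia.
  have [x0 [y0 [xb yb xy Px Py]]] := two_ex tQ.
  split; [exists q0; split | split].
  - lia.
  - by rewrite cE //; lia.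
  - move=> y yb'; rewrite cE; last by lia.
    have [->|yN] := eqVneq y m.+3; first by lia.
    have [->|/eqP yq] := eqVneq y q0; first by lia.
    by rewrite gE => [h|//|//]; [apply: qm|]; lia.
  - by rewrite eN cE.
  have [e|e] := eqVneq x0 q0; [exists y0|exists x0]; rewrite eN cE ?gE; lia.
have {IH} [[q [qb' cq cm]] [cl [r [rl cr]]]] := IH ltac:(lia).
have lm' : ~~ (m.+1 <= l) by lia.
have il : count (leq^~ l) (take (index l (insert_at i m.+1 v)) (insert_at i m.+1 v))
  = count (leq^~ l) (take (index l v) v).
  have lv : l \in v by rewrite (perm_mem_le _ pv); lia.
  have li : index l v < size v by rewrite index_mem.
  have [ij|ji] := ltnP (index l v) i.
    have -> : index l (insert_at i m.+1 v) = index l v.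
      rewrite /insert_at index_cat in_take // ij.
      by rewrite -{2}(cat_take_drop i v) index_cat in_take // ij.
    by rewrite count_take_insert_lo ?sv //; lia.
  have -> : index l (insert_at i m.+1 v) = (index l v).+1.
    have lt : l \notin take i v by rewrite in_take // -leqNgt.
    rewrite /insert_at -{3}(cat_take_drop i v) !index_cat (negbTE lt) /=.
    by rewrite ifN_eqC // addnS.
  by rewrite count_take_insert_hi ?sv.
rewrite il.
have cE x : x < m.+3 ->
    count (leq^~ l) (take (graft m.+3 Q i q0 x) (insert_at i m.+1 v)) =
    count (leq^~ l) (take (Q x) v).
  move=> xm; rewrite /graft /shift_pos /attach_pos ifN /=; last by lia.
  have [iQ|Qi] := leqP i (Q x); last first.
    by rewrite addn0 count_take_insert_lo ?sv //; lia.
  have [->|x0] := eqVneq x 0.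
    by rewrite addn0 (pos_a tQ) !take0.
  have [->|xq] := eqVneq x q0.
    by rewrite addn0 Qq count_take_insert_lo ?sv.
  by rewrite addn1 count_take_insert_hi ?sv.
split; [exists q; split | split].
- lia.
- by rewrite cE //; lia.
- move=> y yb; have [->|yN] := eqVneq y m.+3; first by lia.
  by rewrite cE => [h|]; [apply: cm|]; lia.
- by rewrite cE //; rewrite /num; lia.
by exists r; split=> //; rewrite cE //; move: rl; rewrite /num; lia.
Qed.

(** * Labels and isomorphisms *)

Lemma connect_inv (V : finType) (e : rel V) (Q : pred V) :
  (forall y z, e y z -> Q y -> Q z) -> forall x y, connect e x y -> Q x -> Q y.
Proof.
move=> eQ x y /connectP [p pp ->]; elim: p x pp => //= z p IH x /andP [xz zp] Qx.
exact: IH zp (eQ _ _ xz Qx).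
Qed.

Lemma labelsP (T : lgraph) (X : {set T}) l :
  reflect (exists2 x, x \in X & lab x = Some l) (l \in labels X).
Proof.
rewrite /labels mem_pmap; apply: (iffP mapP) => -[x xX e]; exists x => //.
  by move: xX; rewrite mem_enum.
by rewrite mem_enum.
Qed.

Lemma min_label_spec (T : lgraph) (X : {set T}) l : l \in labels X ->
  min_label X \in labels X /\ min_label X <= l.
Proof.
move=> lX; rewrite /min_label; have := sort_sorted leq_total (labels X).
have ms y : (y \in labels X) = (y \in sort leq (labels X)) by rewrite mem_sort.
move: lX; rewrite !ms.
case: (sort leq _) => //= y s; rewrite inE mem_head => ly ps; split=> //.
case/predU1P: ly => [->//|ls].
by move: ps; rewrite path_sortedE => [/andP [/allP /(_ _ ls)]|]; last exact: leq_trans.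
Qed.

Lemma min_labelE (T : lgraph) (X : {set T}) q : q \in labels X ->
  (forall l, l \in labels X -> q <= l) -> min_label X = q.
Proof.
by move=> qX qm; have [mX mq] := min_label_spec qX; have := qm _ mX; lia.
Qed.

Lemma iso_refl T : iso T T.
Proof. by exists id; split=> //; exists id. Qed.

Lemma iso_degree (T U : lgraph) (f : T -> U) x : bijective f ->
  (forall x y, adj (f x) (f y) = adj x y) -> degree (f x) = degree x.
Proof.
move=> [g fK gK] fa; rewrite /degree -(card_imset _ (can_inj fK)); apply: eq_card => y.
rewrite inE; apply/idP/imsetP => [xy|[z]]; last by rewrite inE => xz ->; rewrite fa.
by exists (g y); rewrite ?gK // inE -fa gK.
Qed.

Lemma iso_leaf_degree T U : iso T U ->
  (forall x : U, isSome (lab x) = (degree x == 1)) ->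
  forall x : T, isSome (lab x) = (degree x == 1).
Proof.
by move=> [f [fb fa fl]] h x; rewrite -fl h (iso_degree _ fb fa).
Qed.

Lemma iso_symmetric T U : iso T U -> symmetric (@adj U) -> symmetric (@adj T).
Proof. by move=> [f [_ fa _]] h x y; rewrite -!fa h. Qed.

(** * Caterpillars laid out along a line *)

(** Adjacency of two vertices of a caterpillar, in terms of their labels (spine
    vertices have none) and of their positions. *)
Definition near (ox oy : option nat) (i j : nat) : bool :=
  match ox, oy with
  | None, None => (i == j.+1) || (j == i.+1)
  | Some _, Some _ => false
  | _, _ => i == j
  end.

(** The spine vertices sit at the positions 0, ..., [m], the leaves are labeled 0,
    ..., [N.-1], and leaf [l] hangs from the vertex at [P l]. Any number of leaves
    may hang from a vertex, so that the notion also covers the trees met just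
    after a leaf is attached and after edges are contracted. *)
Record layout (T : lgraph) (m N : nat) (P : nat -> nat) (pos : T -> nat) : Prop :=
  Layout {
  adj_near : forall x y, adj x y = near (lab x) (lab y) (pos x) (pos y);
  pos_bound : forall x, pos x <= m;
  spine_ex : forall k, k <= m -> exists2 x : T, lab x = None & pos x = k;
  spine_inj : forall x y : T, lab x = None -> lab y = None -> pos x = pos y -> x = y;
  leaf_pos : forall (x : T) l, lab x = Some l -> l < N /\ pos x = P l;
  leaf_ex : forall l, l < N -> exists x : T, lab x = Some l;
  leaf_inj : forall (x y : T) l, lab x = Some l -> lab y = Some l -> x = y
}.

Lemma iso_layout (T U : lgraph) m N P (pos : U -> nat) :
  iso T U -> layout m N P pos -> exists pos' : T -> nat, layout m N P pos'.
Proof.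
move=> [f [fb fa fl]] L; have [g fK gK] := fb; exists (pos \o f); split=> /=.
- by move=> x y; rewrite -fa (adj_near L) !fl.
- by move=> x; apply: (pos_bound L _).
- move=> k km; have [x xl xp] := spine_ex L km.
  by exists (g x); rewrite -?fl /= gK.
- move=> x y xl yl e; apply: (can_inj fK).
  by apply: (spine_inj L) e; rewrite fl.
- by move=> x l xl; apply: (leaf_pos L); rewrite fl.
- by move=> l lN; have [x xl] := leaf_ex L lN; exists (g x); rewrite -fl gK.
- move=> x y l xl yl; apply: (can_inj fK).
  by apply: (leaf_inj L (l := l)); rewrite fl.
Qed.

Lemma eq_layout (T : lgraph) m N P P' (pos : T -> nat) :
  (forall l, l < N -> P l = P' l) -> layout m N P pos -> layout m N P' pos.
Proof.
move=> PP' [h1 h2 h3 h4 h5 h6 h7]; split=> // x l xl.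
by have [lN ->] := h5 _ _ xl; rewrite PP'.
Qed.

(** A vertex is determined by its label and position, and both determine the
    adjacency relation: matching them is an isomorphism. *)
Lemma layout_unique (T U : lgraph) m N P (pos : T -> nat) (pos' : U -> nat) :
  layout m N P pos -> layout m N P pos' -> iso T U.
Proof.
have twin (V W : lgraph) (p : V -> nat) (p' : W -> nat) : layout m N P p ->
    layout m N P p' -> forall x : V, exists y : W, (lab y == lab x) && (p' y == p x).
  move=> L L' x; case xl : (lab x) => [l|].
    have [lN px] := leaf_pos L xl; have [y yl] := leaf_ex L' lN.
    by exists y; have [_ ->] := leaf_pos L' yl; rewrite yl px !eqxx.
  by have [y yl yp] := spine_ex L' (pos_bound L x); exists y; rewrite yl yp !eqxx.
have twin_inj (V : lgraph) (p : V -> nat) : layout m N P p ->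
    forall x y : V, lab x = lab y -> p x = p y -> x = y.
  move=> L x y; case xl : (lab x) => [l|] /esym yl e; first exact: (leaf_inj L xl yl).
  exact: (spine_inj L xl yl e).
move=> L L'; pose f x := xchoose (twin _ _ _ _ L L' x).
pose g x := xchoose (twin _ _ _ _ L' L x).
have fP x : lab (f x) = lab x /\ pos' (f x) = pos x.
  by have /andP [/eqP ? /eqP ?] := xchooseP (twin _ _ _ _ L L' x).
have gP x : lab (g x) = lab x /\ pos (g x) = pos' x.
  by have /andP [/eqP ? /eqP ?] := xchooseP (twin _ _ _ _ L' L x).
exists f; split.
- exists g => x.
    have [e1 e2] := gP (f x); have [e3 e4] := fP x.
    by apply: (twin_inj _ _ L); rewrite ?e1 ?e2.
  have [e1 e2] := fP (g x); have [e3 e4] := gP x.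
  by apply: (twin_inj _ _ L'); rewrite ?e1 ?e2.
- move=> x y; rewrite (adj_near L) (adj_near L').
  by have [-> ->] := fP x; have [-> ->] := fP y.
- by move=> x; have [] := fP x.
Qed.

Section Layout.
Variables (T : lgraph) (m N : nat) (P : nat -> nat) (pos : T -> nat).
Hypothesis L : layout m N P pos.
Implicit Types (v r x y : T) (l k : nat).

Lemma near_sym ox oy i j : near ox oy i j = near oy ox j i.
Proof. by case: ox oy => [?|] [?|] //=; rewrite 1?orbC // eq_sym. Qed.

Lemma layout_sym : symmetric (@adj T).
Proof. by move=> x y; rewrite !(adj_near L) near_sym. Qed.

Lemma layout_irr : irreflexive (@adj T).
Proof. by move=> x; rewrite (adj_near L); case: (lab x) => //=; lia. Qed.

Lemma adj_spine x y : lab x = None -> lab y = None ->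
  adj x y = (pos x == (pos y).+1) || (pos y == (pos x).+1).
Proof. by move=> xl yl; rewrite (adj_near L) xl yl. Qed.

Lemma adj_leaf x y l : lab x = None -> lab y = Some l -> adj x y = (pos x == pos y).
Proof. by move=> xl yl; rewrite (adj_near L) xl yl. Qed.

Lemma leaf_bound x l : lab x = Some l -> l < N.
Proof. by move=> xl; have [] := leaf_pos L xl. Qed.

Lemma leaf_posE x l : lab x = Some l -> pos x = P l.
Proof. by move=> xl; have [] := leaf_pos L xl. Qed.

(** Seen from a spine vertex [v], a branch is a leaf hanging from [v], everything
    to the left of [v], or everything to its right. *)
Lemma branchE v r x : lab v = None -> adj v r ->
  (x \in branch v r) =
  if isSome (lab r) then x == r
  else if pos r < pos v then pos x < pos v else pos v < pos x.
Proof.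
move=> vl vr; rewrite inE; set e := [rel _ _ | _]; set Q := RHS.
have ee y z : adj y z -> y != v -> z != v -> e y z by rewrite /e /= => -> -> ->.
have rv : r != v by apply: contraTneq vr => ->; rewrite layout_irr.
case rl: (lab r) @Q => [l|] /=.
  apply/idP/eqP => [|->]; last exact: connect0.
  move=> c; apply/eqP; move: c (eqxx r).
  apply: (connect_inv (Q := pred1 r)) => y z /and3P [yz yv zv] /eqP yr.
  move: yz vr; rewrite yr (adj_near L) rl (adj_leaf vl rl).
  case zl: (lab z) => [//|] /= /eqP zp /eqP vp; case/eqP: zv.
  by apply: (spine_inj L zl vl _); rewrite vp.
have step y z : e y z -> pos y != pos v -> pos z != pos v /\ (pos y < pos v) = (pos z < pos v).
  move=> /and3P []; rewrite (adj_near L) => yz yv zv pyv.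
  have pzv : pos z != pos v.
    apply/eqP => pzv; move: yz; case zl: (lab z) => [?|].
      by case: (lab y) => //=; lia.
    by case/eqP: zv; apply: (spine_inj L zl vl pzv).
  split=> //; move: yz; case: (lab y) (lab z) => [?|] [?|] //=; lia.
move: (vr); rewrite (adj_spine vl rl) => rp.
have far : connect e r x -> (pos x != pos v) && ((pos x < pos v) == (pos r < pos v)).
  move=> c; apply: (@connect_inv _ e
    (fun y => (pos y != pos v) && ((pos y < pos v) == (pos r < pos v))) _ r x) => //.
    by move=> y z yz /andP [yv /eqP <-]; have [-> ->] := step _ _ yz yv; rewrite eqxx.
  by rewrite eqxx andbT; lia.
have spineward d : forall y, lab y = None -> pos y != pos v ->
    (pos y < pos v) = (pos r < pos v) -> pos y = pos r + d \/ pos r = pos y + d ->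
    connect e r y.
  elim: d => [|d IH] y yl yv sy yd.
    by rewrite (_ : y = r) //; apply: (spine_inj L) => //; lia.
  have [z zl [zp zr]] : exists2 z : T, lab z = None & (pos y = (pos z).+1 \/ pos z = (pos y).+1)
      /\ (pos z = pos r + d \/ pos r = pos z + d).
    case: yd => yd.
      have [|z zl zp] := spine_ex L (k := pos r + d); first by have := pos_bound L y; lia.
      by exists z => //; lia.
    have [|z zl zp] := spine_ex L (k := (pos y).+1); first by have := pos_bound L r; lia.
    by exists z => //; lia.
  have zv : pos z != pos v by lia.
  apply: (connect_trans (IH z zl zv _ _)); [lia|lia|].
  apply: connect1; apply: ee; first by rewrite (adj_spine zl yl); lia.
    by apply: contraNneq zv => ->.
  by apply: contraNneq yv => ->.
have near_x : pos x != pos v -> (pos x < pos v) = (pos r < pos v) -> connect e r x.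
  move=> xv sx; have [z zl zp] := spine_ex L (pos_bound L x).
  have cz : connect e r z.
    have [rz|zr] := leqP (pos r) (pos z).
      by apply: (spineward (pos z - pos r)) => //; lia.
    by apply: (spineward (pos r - pos z)) => //; lia.
  case xl: (lab x) => [l|]; last by rewrite (spine_inj L xl zl) // zp.
  apply: (connect_trans cz); apply: connect1; apply: ee.
  - by rewrite (adj_leaf zl xl) zp.
  - by apply: contraNneq xv => <-; rewrite zp.
  - by apply: contraNneq xv => <-.
apply/idP/idP => [/far|xQ]; first by case: ifP; lia.
by apply: near_x; move: xQ; case: ifP; lia.
Qed.

Lemma root_towardE v r y l : lab y = Some l ->
  root_toward v l r = adj v r && (y \in branch v r).
Proof.
move=> yl; rewrite /root_toward; congr (_ && _).
apply/labelsP/idP => [[z zb zl]|yb]; last by exists y.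
by rewrite (leaf_inj L yl zl).
Qed.

End Layout.

(** * Layouts with internal vertices of degree 3 *)

Lemma uniq_pmap_inj (A B : eqType) (f : A -> option B) (s : seq A) :
  (forall x y b, f x = Some b -> f y = Some b -> x = y) -> uniq s -> uniq (pmap f s).
Proof.
move=> fi; elim: s => //= x s IH /andP [xs us].
case e: (f x) => [b|] /=; last exact: IH.
rewrite IH // andbT mem_pmap; apply: contra xs => /mapP [y ys yb].
by rewrite (fi x y b).
Qed.

Section LayoutTree.
Variables (T : lgraph) (m N : nat) (P : nat -> nat) (pos : T -> nat).
Hypothesis L : layout m N P pos.
Implicit Types (v r x y : T) (l k : nat).

(** Order the vertices from left to right, each leaf coming just after the vertex
    it hangs from. Every vertex has at most one earlier neighbour, whereas the
    last vertex of a cycle would have two. *)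
Lemma layout_acyclic (p : seq T) : ucycle (@adj T) p -> size p <= 2.
Proof.
move=> cp; rewrite leqNgt; apply/negP => sp.
pose rank x := (pos x).*2 + isSome (lab x).
have [x0 x0p] : exists x0, x0 \in p.
  by case: p sp {cp} => // x p _; exists x; apply: mem_head.
have [x xp xmax] : exists2 x, x \in p & forall u, u \in p -> rank u <= rank x.
  by case: (@arg_maxnP _ x0 (mem p) rank x0p) => x xp xm; exists x.
have lower y z : rank y <= rank x -> rank z <= rank x -> adj x y -> adj x z -> y = z.
  have below u : rank u <= rank x -> adj x u ->
      lab u = None /\ (pos u).+1 = pos x + isSome (lab x).
    rewrite /rank (adj_near L); case: (lab x) (lab u) => [?|] [?|] //= ru xu; split=> //; lia.
  move=> yx zx /below [//|yl yp] /below [//|zl zp].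
  by apply: (spine_inj L yl zl _); lia.
have [i q pq] := rot_to xp.
move: cp sp; rewrite -(rot_ucycle i) -(size_rot i) pq => /andP [].
have qx u : u \in q -> rank u <= rank x.
  by move=> uq; apply: xmax; rewrite -(mem_rot i) pq inE uq orbT.
case: q qx {pq} => [|y q] qx //; case: (lastP q) qx => [//|{}q z] qx.
rewrite /= rcons_path last_rcons => /and3P [xy _ zx] /and3P [_ yq _] _.
case/negP: yq; rewrite mem_rcons inE; apply/orP; left; apply/eqP.
apply: lower => //; last by rewrite (layout_sym L).
  by apply: qx; rewrite mem_head.
by apply: qx; rewrite inE mem_rcons mem_head orbT.
Qed.

Lemma spine_fun : exists S : nat -> T, forall k, k <= m -> lab (S k) = None /\ pos (S k) = k.
Proof.
have [x0 _ _] := spine_ex L (leq0n m).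
exists (fun k => odflt x0 [pick x | (lab x == None) && (pos x == k)]) => k km.
case: pickP => [x /andP [/eqP ? /eqP ?] //|].
by have [x xl xp] := spine_ex L km => /(_ x); rewrite xl xp !eqxx.
Qed.

Lemma layout_connected x y : connect (@adj T) x y.
Proof.
have [S Sk] := spine_fun; have sc := sym_connect_sym (layout_sym L).
have c0 k : k <= m -> connect (@adj T) (S 0) (S k).
  elim: k => [|k IH] km; first exact: connect0.
  apply: (connect_trans (IH (ltnW km))); apply: connect1.
  have [l1 p1] := Sk k (ltnW km); have [l2 p2] := Sk _ km.
  by rewrite (adj_spine L l1 l2) p1 p2 eqxx orbT.
have cx z : connect (@adj T) (S 0) z.
  have zm := pos_bound L z; have [l1 p1] := Sk _ zm.
  apply: (connect_trans (c0 _ zm)); case zl: (lab z) => [l|].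
    by apply: connect1; rewrite (adj_leaf L l1 zl) p1.
  by rewrite (spine_inj L l1 zl p1).
by apply: connect_trans (cx y); rewrite sc.
Qed.

Lemma layout_is_tree : is_tree T.
Proof.
split; [exact: layout_sym L | exact: layout_irr L | exact: layout_connected |].
exact: layout_acyclic.
Qed.

Lemma leaf_degree x l : lab x = Some l -> degree x = 1.
Proof.
move=> xl; have [z zl zp] := spine_ex L (pos_bound L x).
rewrite /degree -(cards1 z); apply: eq_card => y; rewrite !inE (layout_sym L).
apply/idP/eqP => [|->]; last by rewrite (adj_leaf L zl xl) zp.
rewrite (adj_near L) xl; case yl: (lab y) => [//|] /= /eqP yx.
by apply: (spine_inj L yl zl _); rewrite zp.
Qed.

Lemma uniq_labels : uniq (labels [set: T]).
Proof.
apply: uniq_pmap_inj (enum_uniq _) => x y l; exact: (leaf_inj L).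
Qed.

Lemma at_leafE v y l : lab v = None -> lab y = Some l ->
  at_leaf l v = (pos v == pos y).
Proof.
move=> vl yl; rewrite -(adj_leaf L vl yl) (layout_sym L).
apply/existsP/idP => [[x /andP [/eqP xl]]|yv]; last by exists y; rewrite yl eqxx.
by rewrite (leaf_inj L xl yl).
Qed.

End LayoutTree.

Section Trivalent.
Variables (T : lgraph) (n : nat) (P : nat -> nat) (pos : T -> nat).
Hypotheses (L : layout n n.+3 P pos) (tP : trivalent_pos n P).
Implicit Types (v r x y : T) (l k : nat).

Lemma leaf_cases x l : lab x = Some l -> l = 0 \/ 0 < l < n.+3.
Proof. by move/(leaf_bound L); lia. Qed.

(** The neighbour on the side of [a] is a leaf at position 0 and a spine vertex
    elsewhere; the two others are a leaf and the next spine vertex, or two leaves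
    at the last position. *)
Lemma spine_neighbors v : lab v = None ->
  exists s : seq T, [/\ uniq s, size s = 3 & forall y, adj v y = (y \in s)].
Proof.
move=> vl; have vn := pos_bound L v.
have lP := leaf_posE L.
have [u1 u1P] : exists u1, forall y, (y == u1) =
    if lab y is Some l then (pos v == 0) && (l == 0) else (pos y).+1 == pos v.
  have [v0|v0] := eqVneq (pos v) 0.
    have [u ul] := leaf_ex L (isT : 0 < n.+3); exists u => y.
    case yl: (lab y) => [l|] /=; last by rewrite v0; apply: contraPF yl => /eqP ->; rewrite ul.
    apply/eqP/eqP => [yu|l0]; first by move: yl; rewrite yu ul => -[].
    by apply: (leaf_inj L _ ul); rewrite yl l0.
  have [u ul up] := spine_ex L (k := (pos v).-1) ltac:(lia); exists u => y.
  case yl: (lab y) => [l|] /=; first by apply: contraPF yl => /eqP ->; rewrite ul.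
  apply/eqP/eqP => [->|yv]; first by rewrite up; lia.
  by apply: (spine_inj L yl ul _); lia.
have leafE u l y : lab u = Some l ->
    (y == u) = if lab y is Some k then k == l else false.
  move=> ul; case yl: (lab y) => [k|]; last by apply: contraPF yl => /eqP ->; rewrite ul.
  apply/eqP/eqP => [yu|kl]; first by move: yl; rewrite yu ul => -[].
  by apply: (leaf_inj L _ ul); rewrite yl kl.
have [vlt|vge] := ltnP (pos v) n.
  have [l lb Pl] := one_ex tP vlt; have [u2 u2l] := leaf_ex L (l := l) ltac:(lia).
  have [u3 u3l u3p] := spine_ex L (k := (pos v).+1) ltac:(lia).
  have u3E y : (y == u3) = (lab y == None) && (pos y == (pos v).+1).
    apply/eqP/andP => [->|[/eqP yl /eqP yp]]; first by rewrite u3l u3p !eqxx.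
    by apply: (spine_inj L yl u3l _); rewrite u3p.
  exists [:: u1; u2; u3]; split=> //.
    rewrite /= !inE !(eq_sym u1) !u1P u2l u3l u3E u2l /= u3p andbT; lia.
  move=> y; rewrite !inE u1P u3E (leafE _ _ _ u2l) (adj_near L) vl.
  case yl: (lab y) => [k|] /=; last by rewrite eq_sym; lia.
  rewrite orbF (lP _ _ yl); have [k0|kb] := leaf_cases yl.
    by rewrite k0 (pos_a tP); lia.
  apply/eqP/orP => [vk|[|/eqP ->]]; [right|lia|by []].
  by apply/eqP; apply: (one_uniq tP) => //; rewrite -?vk ?Pl.
have en : pos v = n by lia.
have [l1 [l2 [l1b l2b l12 Pl1 Pl2]]] := two_ex tP.
have [u2 u2l] := leaf_ex L (l := l1) ltac:(lia).
have [u3 u3l] := leaf_ex L (l := l2) ltac:(lia).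
exists [:: u1; u2; u3]; split=> //.
  rewrite /= !inE !(eq_sym u1) !u1P (leafE _ _ _ u3l) u2l u3l /= andbT; lia.
move=> y; rewrite !inE u1P (leafE _ _ _ u2l) (leafE _ _ _ u3l) (adj_near L) vl.
case yl: (lab y) => [k|] /=; last by have := pos_bound L y; lia.
rewrite (lP _ _ yl); have [k0|kb] := leaf_cases yl.
  by rewrite k0 (pos_a tP) andbT; lia.
apply/eqP/or3P => [vk|[|/eqP ->|/eqP ->]]; [|lia|lia|lia].
have := two_max tP kb l1b l2b; rewrite -vk en => /(_ erefl Pl1 Pl2).
by case/or3P => [kl|e|kl]; [constructor 2 | rewrite e in l12 | constructor 3].
Qed.

Lemma spine_degree v : lab v = None -> degree v = 3.
Proof.
move/spine_neighbors => [s [us <- sP]]; rewrite -(card_uniqP us).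
by apply: eq_card => y; rewrite !inE sP.
Qed.

Lemma layout_internal v : internal v = (lab v == None).
Proof.
rewrite /internal; case vl: (lab v) => [l|]; first by rewrite (leaf_degree L vl).
by rewrite (spine_degree vl).
Qed.

Lemma layout_trivalent : trivalent T.
Proof. by move=> v; rewrite layout_internal => /eqP; apply: spine_degree. Qed.

Lemma layout_stable : stable_tree T.
Proof.
split; first exact: layout_is_tree L.
- move=> x; case xl: (lab x) => [l|]; first by rewrite (leaf_degree L xl).
  by rewrite (spine_degree xl).
- exact: uniq_labels L.
- move=> x; case xl: (lab x) => [l|]; first by rewrite (leaf_degree L xl).
  by rewrite (spine_degree xl).
- have [x xl _] := spine_ex L (leq0n n); exists x.
  by rewrite (spine_degree xl).
Qed.

Variable S : nat -> T.
Hypothesis SP : forall k, k <= n -> lab (S k) = None /\ pos (S k) = k.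

Lemma spine_funE x : lab x = None -> x = S (pos x).
Proof.
move=> xl; have [l1 p1] := SP (pos_bound L x).
by apply: (spine_inj L xl l1 _); rewrite p1.
Qed.

Lemma spine_seqP : is_internal_path [seq S k | k <- iota 0 n.+1].
Proof.
apply/and3P; split.
- rewrite sorted_map; apply/(sortedP 0) => i; rewrite size_iota => ib.
  rewrite !nth_iota ?add0n /=; try lia.
  have [l1 p1] := SP (k := i) ltac:(lia); have [l2 p2] := SP (k := i.+1) ltac:(lia).
  by rewrite (adj_spine L l1 l2) p1 p2 eqxx orbT.
- rewrite map_inj_in_uniq ?iota_uniq // => i j; rewrite !mem_iota => ib jb e.
  have [_ <-] := SP (k := i) ltac:(lia); have [_ <-] := SP (k := j) ltac:(lia).
  by rewrite e.
apply/forallP => v; apply/eqP; rewrite layout_internal.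
apply/mapP/eqP => [[k]|vl].
  by rewrite mem_iota => kb ->; have [] := SP (k := k) ltac:(lia).
exists (pos v); last exact: spine_funE.
by rewrite mem_iota; have := pos_bound L v; lia.
Qed.

Lemma layout_caterpillar : caterpillar T.
Proof. by eexists; apply: spine_seqP. Qed.

(** A path through all the spine that starts at the end where [a] hangs cannot turn
    back, so it follows the positions. *)
Lemma internal_path_eq x p : is_internal_path (x :: p) -> at_leaf la x ->
  x :: p = [seq S k | k <- iota 0 n.+1].
Proof.
move=> ip ax; have := spine_seqP; set q := map _ _ => iq.
have xl y : y \in x :: p -> lab y = None.
  by case/and3P: ip => _ _ /forallP /(_ y) /eqP ->; rewrite layout_internal => /eqP.
have [y0 y0l] := leaf_ex L (isT : 0 < n.+3).
have px : pos x = 0.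
  move: ax; rewrite (at_leafE L (xl x (mem_head _ _)) y0l) => /eqP ->.
  by rewrite (leaf_posE L y0l) (pos_a tP).
have spq : size (x :: p) = size q.
  apply: perm_size; apply: uniq_perm; [by case/and3P: ip | by case/and3P: iq |] => y.
  case/and3P: ip => _ _ /forallP /(_ y) /eqP ->.
  by case/and3P: iq => _ _ /forallP /(_ y) /eqP ->.
apply: (eq_from_nth (x0 := x) spq) => i ip'.
have sq : size q = n.+1 by rewrite size_map size_iota.
rewrite (nth_map 0) ?nth_iota ?size_iota; try lia; rewrite add0n.
elim/ltn_ind: i ip' => -[|[|i]] IH ip'.
- by rewrite /= {1}(spine_funE (xl x (mem_head _ _))) px.
- case/and3P: ip => /(sortedP x) /(_ 0 ip') /= aq _ _.
  have l1 := xl _ (mem_nth x ip'); apply: (etrans (spine_funE l1)); congr S.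
  by move: aq; rewrite (adj_spine L (xl x (mem_head _ _)) l1) px /=; lia.
- have e1 := IH i.+1 ltac:(lia) ltac:(lia); have e0 := IH i ltac:(lia) ltac:(lia).
  case/and3P: ip => /(sortedP x) /(_ i.+1 ip') aq up _.
  have l1 := xl _ (mem_nth x ip').
  have l2 := xl _ (mem_nth x (ltnW ip')).
  apply: (etrans (spine_funE l1)); congr S; move: aq; rewrite (adj_spine L l2 l1) e1.
  have [_ ->] := SP (k := i.+1) ltac:(lia).
  case/orP => /eqP e; last by [].
  have : nth x (x :: p) i.+2 = nth x (x :: p) i.
    by rewrite e0 (spine_funE l1); congr S; lia.
  by move/eqP; rewrite (nth_uniq _ ip' (ltnW (ltnW ip')) up); lia.
Qed.

Lemma spineE : spine T = [seq S k | k <- iota 0 n.+1].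
Proof.
rewrite /spine; case: pickP => [p /andP []|none].
  case: p => -[|x p] pi //= ip ax; exact: internal_path_eq.
have ip := spine_seqP; set q := [seq S k | k <- _] in ip *.
have sq : size q == #|[set v : T | internal v]|.
  case/and3P: ip => _ uq /forallP mq; rewrite -(card_uniqP uq); apply/eqP/eq_card => y.
  by rewrite !inE -(eqP (mq y)).
have := none (Tuple sq); rewrite /= ip /=.
have [l0 p0] := SP (leq0n n); have [y0 y0l] := leaf_ex L (isT : 0 < n.+3).
by rewrite (at_leafE L l0 y0l) p0 (leaf_posE L y0l) (pos_a tP).
Qed.

End Trivalent.

(** * Paths through the internal vertices of a tree *)

(** Otherwise the part of the path between [x] and [y] would close up to a cycle. *)
Lemma tree_path_consecutive (T : lgraph) (p : seq T) x y :
  is_tree T -> sorted (@adj T) p -> uniq p -> x \in p -> y \in p -> adj x y ->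
  exists p1 p2, p = p1 ++ x :: y :: p2 \/ p = p1 ++ y :: x :: p2.
Proof.
move=> [sT iT _ acT].
have main p1 p2 u v : sorted (@adj T) (p1 ++ u :: p2) -> uniq (p1 ++ u :: p2) ->
    v \in p2 -> adj u v -> exists q, p2 = v :: q.
  move=> sp up /splitPr vp uv; case: vp sp up => q1 q2 sp up.
  suff -> : q1 = [::] by exists q2.
  apply/size0nil/eqP; rewrite -leqn0 -(leq_add2r 2) add0n addn2.
  have sp' : sorted (@adj T) (p1 ++ (u :: rcons q1 v) ++ q2) by rewrite /= cat_rcons.
  have up' : uniq (p1 ++ (u :: rcons q1 v) ++ q2) by rewrite /= cat_rcons.
  have := acT (u :: rcons q1 v); rewrite /= size_rcons; apply.
  apply/andP; split.
    rewrite /= rcons_path last_rcons sT uv andbT.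
    by case/cat_sorted2: sp' => _ /cat_sorted2 [].
  by move: up'; rewrite !cat_uniq => /and3P [_ _ /and3P []].
move=> sp up /splitPr xp yp xy; case: xp sp up yp => p1 p2 sp up.
rewrite mem_cat inE => /or3P [yp|/eqP yx|yp].
- case/splitPr: yp sp up => q1 q2; rewrite -catA /= => sp up.
  have [||q ->] := main _ _ _ x sp up; last by exists q1, q; right.
    by rewrite mem_cat mem_head orbT.
  by rewrite sT.
- by move: xy; rewrite yx iT.
- by have [q ->] := main _ _ _ _ sp up yp xy; exists p1, q; left.
Qed.

(** In a stable tree the internal vertices are the unlabeled ones. Referring to
    labels instead of degrees makes this notion easy to follow through an
    attachment or a slide, which change degrees but no label. *)
Definition spine_path (T : lgraph) (p : seq T) : bool :=
  [&& sorted (@adj T) p, uniq p & [forall v, (v \in p) == (lab v == None)]].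

Lemma spine_pathP (T : lgraph) (p : seq T) : spine_path p ->
  [/\ sorted (@adj T) p, uniq p & forall v, (v \in p) = (lab v == None)].
Proof. by case/and3P=> ? ? /forallP mp; split=> // v; apply/eqP. Qed.

Lemma caterpillar_spine_path (T : lgraph) :
  (forall x : T, isSome (lab x) = (degree x == 1)) -> caterpillar T ->
  exists p : seq T, spine_path p.
Proof.
move=> ld [p /and3P [sp up /forallP mp]]; exists p; apply/and3P; split=> //.
by apply/forallP => v; rewrite (eqP (mp v)) /internal -ld; case: (lab v).
Qed.

Lemma iso_spine_path (T U : lgraph) : iso T U ->
  (exists p : seq T, spine_path p) -> exists p : seq U, spine_path p.
Proof.
move=> [f [[g fK gK] fa fl]] [p /spine_pathP [sp up mp]]; exists [seq f x | x <- p].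
apply/and3P; split.
- by rewrite sorted_map (@eq_sorted _ _ (@adj T)) // => x y /=; rewrite fa.
- by rewrite map_inj_uniq //; apply: can_inj fK.
apply/forallP => v; rewrite -{1}(gK v) mem_map; last exact: can_inj fK.
by rewrite mp -fl gK.
Qed.

Lemma spine_path_three (T : lgraph) (p : seq T) (x y1 y2 y3 : T) :
  is_tree T -> spine_path p -> lab x = None -> lab y1 = None -> lab y2 = None ->
  lab y3 = None -> adj x y1 -> adj x y2 -> adj x y3 ->
  y1 <> y2 -> y1 <> y3 -> y2 <> y3 -> False.
Proof.
move=> tT /spine_pathP [sp up mp] xl l1 l2 l3 a1 a2 a3.
have inp (v : T) : lab v = None -> v \in p by move=> vl; rewrite mp vl.
have cons (y : T) : lab y = None -> adj x y ->
    index y p = (index x p).+1 \/ index x p = (index y p).+1.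
  move=> yl xy; have [p1 [p2 e]] := tree_path_consecutive tT sp up (inp _ xl) (inp _ yl) xy.
  have xy' : x != y by apply: contraTneq xy => ->; case: tT => _ ->.
  case: e up => ->; rewrite cat_uniq /= => /and3P [_ /norP [h1 /norP [h2 _]] _].
    left; rewrite !index_cat (negbTE h1) (negbTE h2) /= !eqxx (negbTE xy').
    by rewrite addn0 addn1.
  right; rewrite !index_cat (negbTE h1) (negbTE h2) /= !eqxx eq_sym (negbTE xy').
  by rewrite addn0 addn1.
have inj (y z : T) : lab y = None -> lab z = None -> index y p = index z p -> y = z.
  move=> yl zl e; rewrite -(nth_index x (inp _ yl)) e nth_index //; exact: inp.
have := cons _ l1 a1; have := cons _ l2 a2; have := cons _ l3 a3.
move=> c3 c2 c1 n12 n13 n23.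
have [e|e] := eqVneq (index y1 p) (index y2 p); first by apply: n12; apply: inj.
have [e'|e'] := eqVneq (index y1 p) (index y3 p); first by apply: n13; apply: inj.
by apply: n23; apply: inj => //; lia.
Qed.

Lemma attach_spine_path (T : lgraph) l (v : T) :
  (exists p : seq (attach_at l v), spine_path p) -> exists p : seq T, spine_path p.
Proof.
move=> [p /spine_pathP [sp up mp]]; exists (pmap id p).
have ep : p = map Some (pmap id p).
  rewrite pmapS_filter map_id; apply/esym/all_filterP/allP => -[x|] //.
  by rewrite mp.
apply/and3P; split.
- by move: sp; rewrite {1}ep sorted_map; apply: sub_sorted.
- by rewrite ep map_inj_uniq in up => //; apply: Some_inj.
apply/forallP => x; have := mp (Some x); rewrite {1}ep mem_map /=; last exact: Some_inj.
by move=> ->.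
Qed.

Lemma sorted_cat_cons_eq (A : Type) (e : rel A) p1 x p2 :
  sorted e (p1 ++ x :: p2) = sorted e (rcons p1 x) && path e x p2.
Proof. by case: p1 => //= y p1; rewrite cat_path rcons_path /= andbA. Qed.

(** A slide splits [v] into [v] and the new vertex. These are consecutive in the spine
    of the new tree, and merging them gives a spine of the old one. *)
Lemma move_spine_path (T : lgraph) (v : T) (M : {set T}) :
  symmetric (@adj T) -> (forall x, x \in M -> adj v x) -> lab v = None ->
  is_tree (move_branches v M) ->
  (exists p : seq (move_branches v M), spine_path p) ->
  exists p : seq T, spine_path p.
Proof.
move=> sT Mv vl tU [p /spine_pathP [sp up mp]].
set U := move_branches v M in tU p sp up mp.
pose n0 : U := None; pose v0 : U := Some v.
pose g (x : U) : T := odflt v x.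
have gadj (c x y : U) : c = n0 \/ c = v0 -> x != c -> y != c -> adj x y -> adj (g x) (g y).
  case: x y => [x|] [y|] cc xc yc //=; first by case/andP.
    have [xv|xv] := eqVneq x v; last by move/Mv; rewrite sT.
    by case: cc xc yc => ->; rewrite ?xv eqxx.
  have [yv|yv] := eqVneq y v; last by move/Mv.
  by case: cc xc yc => ->; rewrite ?yv eqxx.
have [a [b [p1 [p2 [ep ab]]]]] : exists a b p1 p2, p = p1 ++ a :: b :: p2 /\
    (a = n0 /\ b = v0 \/ a = v0 /\ b = n0).
  have n0p : n0 \in p by rewrite mp.
  have v0p : v0 \in p by rewrite mp /= vl.
  have [p1 [p2 [e|e]]] := tree_path_consecutive tU sp up n0p v0p (introT orP (or_introl (eqxx v))).
    by exists n0, v0, p1, p2; split; [|left].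
  by exists v0, n0, p1, p2; split; [|right].
have [ca cb] : (a = n0 \/ a = v0) /\ (b = n0 \/ b = v0) by case: ab => -[-> ->]; split; auto.
have [ga gb] : g a = v /\ g b = v by case: ab => -[-> ->].
have uq := up; rewrite ep cat_uniq /= in uq.
have /and5P [u1 /norP [a1 /norP [b1 h12]] ab2 b2 u2] := uq.
move: ab2; rewrite inE => /norP [anb a2].
exists (map g (p1 ++ a :: p2)); apply/and3P; split.
- move: sp; rewrite ep sorted_cat_cons_eq /= => /and3P [s1 _ s2].
  rewrite map_cat /= sorted_cat_cons_eq -map_rcons; apply/andP; split.
    apply: (homo_sorted_in (P := predC1 b)) s1.
      by move=> x y xb yb; apply: gadj cb xb yb.
    rewrite all_rcons /= anb; apply/allP => x xp; apply: contraNneq b1 => <-.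
    exact: xp.
  rewrite ga -gb; apply: (homo_path_in (P := predC1 a)) s2.
    by move=> x y xa ya; apply: gadj ca xa ya.
  rewrite /= eq_sym anb; apply/allP => x xp; apply: contraNneq a2 => <-.
  exact: xp.
- rewrite map_inj_in_uniq.
    rewrite cat_uniq /= u1 u2 a2 (negbTE a1) h12 //.
  have nb x : x \in p1 ++ a :: p2 -> x != b.
    move=> xp; apply: contraTneq xp => ->; rewrite mem_cat inE (negbTE b1) (negbTE b2) /=.
    by rewrite eq_sym (negbTE anb).
  move=> x y /nb xb /nb yb; case: ab xb yb => -[_ ->]; case: x y => [x|] [y|] //=.
  + by move=> _ _ ->.
  + by move=> xv _ e; rewrite e eqxx in xv.
  + by move=> _ yv e; rewrite -e eqxx in yv.
  + by move=> _ _ ->.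
apply/forallP => x; apply/eqP.
have mem y : (y \in p1 ++ a :: p2) = (lab y == None) && (y != b).
  rewrite -mp ep !mem_cat !inE; have [->|yb] := eqVneq y b; last by rewrite andbT.
  by rewrite andbF (negbTE b1) (negbTE b2) eq_sym (negbTE anb).
apply/mapP/eqP => [[y]|xl].
  by rewrite mem => /andP [/eqP yl _] ->; case: y yl => [y|] //= _.
have [xb|xb] := eqVneq (Some x : U) b.
  exists a; first by rewrite mem_cat mem_head orbT.
  by rewrite ga -gb -xb.
by exists (Some x) => //; rewrite mem /= xl xb.
Qed.

(** * Attaching a leaf and sliding in a layout *)

Lemma attach_layout (T : lgraph) m N P (pos : T -> nat) (v : T) :
  layout m N P pos -> lab v = None ->
  layout m N.+1 (attach_pos N P (pos v))
    (fun x : attach_at N v => if x is Some y then pos y else pos v).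
Proof.
move=> L vl; split.
- move=> [x|] [y|] //=; first exact: adj_near L _ _.
    case xl: (lab x) => [l|] /=; first by apply: contraPF xl => /eqP ->; rewrite vl.
    by apply/eqP/eqP => [->//|]; apply: (spine_inj L).
  case yl: (lab y) => [l|] /=; first by apply: contraPF yl => /eqP ->; rewrite vl.
  by rewrite eq_sym; apply/eqP/eqP => [->//|e]; apply/esym/(spine_inj L).
- by move=> [x|]; apply: (pos_bound L).
- by move=> k /(spine_ex L) [x xl xp]; exists (Some x).
- by move=> [x|] [y|] //= xl yl e; congr Some; apply: (spine_inj L).
- move=> [x|] l /= => [xl|[<-]]; last by rewrite /attach_pos eqxx.
  have [lN ->] := leaf_pos L xl; split; first by lia.
  by rewrite /attach_pos ifN //; lia.
- move=> l; rewrite ltnS leq_eqVlt => /predU1P [->|lN]; first by exists None.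
  by have [x xl] := leaf_ex L lN; exists (Some x).
- move=> [x|] [y|] l //= => [xl yl|xl [yl]|[xl] yl].
  + by congr Some; apply: (leaf_inj L xl yl).
  + by have := leaf_bound L xl; lia.
  + by have := leaf_bound L yl; lia.
Qed.

(** The roots of the branch of [a] and of the leaf [q], at a spine vertex at [j]. *)
Definition moved (T : lgraph) (pos : T -> nat) (j q : nat) (x : T) : bool :=
  if lab x is Some l then (l == q) || ((l == 0) && (j == 0)) else (pos x).+1 == j.

Lemma move_layout (T : lgraph) m N P (pos : T -> nat) (v : T) (M : {set T}) q :
  layout m N P pos -> lab v = None -> P 0 = 0 -> 0 < q < N -> P q = pos v ->
  (forall x, (x \in M) = moved pos (pos v) q x) ->
  layout m.+1 N (shift_pos P (pos v) q)
    (fun x : move_branches v M => if x is Some y then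
       pos y + ((pos v <= pos y) && (if lab y is Some l then (l != 0) && (l != q) else true))
     else pos v).
Proof.
move=> L vl P0 qb Pq ME; set j := pos v in ME Pq *.
have vE x : lab x = None -> (x == v) = (pos x == j).
  by move=> xl; apply/eqP/eqP => [->//|]; apply: (spine_inj L).
have vE' x l : lab x = Some l -> (x == v) = false.
  by move=> xl; apply: contraPF xl => /eqP ->; rewrite vl.
have lP := leaf_posE L.
have jm : j <= m := pos_bound L v.
split.
- move=> [x|] [y|] //=; rewrite ?ME /moved ?(adj_near L).
  + case xl: (lab x) => [l|]; case yl: (lab y) => [k|] //=; rewrite ?(lP _ _ xl) ?(lP _ _ yl).
    * rewrite (vE' _ _ xl) (vE _ yl) /=.
      have [->|k0] := eqVneq l 0; first by rewrite P0 /=; lia.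
      have [->|kq] := eqVneq l q; first by rewrite Pq /=; lia.
      by rewrite /=; lia.
    * rewrite (vE' _ _ yl) (vE _ xl) /= andbT.
      have [->|k0] := eqVneq k 0; first by rewrite P0 /=; lia.
      have [->|kq] := eqVneq k q; first by rewrite Pq /=; lia.
      by rewrite /=; lia.
    * by rewrite (vE _ yl) (vE _ xl); lia.
  + case xl: (lab x) => [l|]; last by rewrite (vE _ xl) /=; lia.
    rewrite (vE' _ _ xl) (lP _ _ xl) /=.
    have [->|k0] := eqVneq l 0; first by rewrite P0 /=; lia.
    have [->|kq] := eqVneq l q; first by rewrite Pq /=; lia.
    by rewrite /=; lia.
  + case xl: (lab y) => [l|]; last by rewrite (vE _ xl) /=; lia.
    rewrite (vE' _ _ xl) (lP _ _ xl) /=.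
    have [->|k0] := eqVneq l 0; first by rewrite P0 /=; lia.
    have [->|kq] := eqVneq l q; first by rewrite Pq /=; lia.
    by rewrite /=; lia.
  + by lia.
- move=> [x|]; last by lia.
  by have := pos_bound L x; case: (_ && _) => /=; lia.
- move=> k km; have [kj|] := ltnP k j.
    have [x xl xp] := spine_ex L (k := k) ltac:(lia).
    by exists (Some x); rewrite //= xl xp andbT; lia.
  rewrite leq_eqVlt => /predU1P [<-|jk]; first by exists None.
  have [x xl xp] := spine_ex L (k := k.-1) ltac:(lia).
  by exists (Some x); rewrite //= xl xp andbT; lia.
- move=> [x|] [y|] //= xl yl; rewrite ?xl ?yl ?andbT => e.
  + by congr Some; apply: (spine_inj L xl yl); lia.
  + by lia.
  + by lia.
- move=> [x|] l //= xl; have [lN ->] := leaf_pos L xl; split=> //.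
  by rewrite xl.
- by move=> l /(leaf_ex L) [x xl]; exists (Some x).
- by move=> [x|] [y|] l //= xl yl; congr Some; apply: (leaf_inj L xl yl).
Qed.

(** The tree just after the leaf [n.+3] has been attached to the spine vertex at [j]. *)
Section SlideStep.
Variables (T : lgraph) (n j : nat) (P : nat -> nat) (pos : T -> nat).
Hypotheses (tP : trivalent_pos n P) (L : layout n n.+4 (attach_pos n.+3 P j) pos).
Variables (v li : T).
Hypotheses (vl : lab v = None) (vj : pos v = j) (lil : lab li = Some n.+3).
Implicit Types (r x y : T) (l : nat).

Let old_pos x l : lab x = Some l -> l < n.+3 -> pos x = P l.
Proof. by move=> xl ln; rewrite (leaf_posE L xl) /attach_pos ifN //; lia. Qed.

Let jn : j <= n. Proof. by rewrite -vj; apply: (pos_bound L). Qed.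

Lemma root_toward_a r : root_toward v la r =
  adj v r && (if lab r is Some l then (l == 0) && (j == 0) else (pos r).+1 == j).
Proof.
have [a al] := leaf_ex L (isT : la < n.+4); rewrite (root_towardE L _ _ al).
case vr: (adj v r) => //=; rewrite (branchE L a vl vr).
have pa : pos a = 0 by rewrite (old_pos al) // (pos_a tP).
case rl: (lab r) => [l|] /=; rewrite ?pa.
  move: vr; rewrite (adj_leaf L vl rl) vj => /eqP jr.
  apply/eqP/andP => [ar|[/eqP l0 _]]; last by apply: (leaf_inj L al); rewrite rl l0.
  by move: al rl; rewrite ar jr -ar pa => -> [<-].
by move: vr; rewrite (adj_spine L vl rl) vj; case: ifP; lia.
Qed.

(** Everything that is neither in the branch of [a] nor the new leaf sits at or after
    position [j]. *)
Lemma away_labels r l : root_toward v la r ->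
  (l \in labels (~: (branch v r :|: [set li]))) = (0 < l < n.+3) && (j <= P l).
Proof.
move=> rr; move: (rr); rewrite root_toward_a => /andP [vr rA].
have [a al] := leaf_ex L (isT : la < n.+4).
have ab : a \in branch v r by move: rr; rewrite (root_towardE L _ _ al) => /andP [].
have xb x k : lab x = Some k -> 0 < k -> (x \in branch v r) = (pos x < j).
  move=> xk k0; rewrite (branchE L x vl vr) vj; case rl: (lab r) rA => [k'|] /=;
    last by move=> rA; rewrite ifT //; lia.
  case/andP=> /eqP k'0 /eqP j0; rewrite j0 ltn0; apply: contraPF xk => /eqP ->.
  by rewrite rl k'0; case: k k0.
apply/labelsP/andP => [[x]|[lb jl]].
  rewrite in_setC in_setU in_set1 negb_or => /andP [xr xli] xl.
  have l0 : 0 < l.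
    rewrite lt0n; apply: contra xr => /eqP l0.
    by rewrite (_ : x = a) //; apply: (leaf_inj L _ al); rewrite xl l0.
  have lN : l <> n.+3 by move=> e; case/eqP: xli; apply: (leaf_inj L _ lil); rewrite xl e.
  have lb := leaf_bound L xl; split; first by lia.
  by move: xr; rewrite (xb _ _ xl l0) (old_pos xl); lia.
have [x xl] := leaf_ex L (l := l) ltac:(lia); exists x => //.
rewrite in_setC in_setU in_set1 negb_or (xb _ _ xl) ?(old_pos xl); try lia.
apply/andP; split; first by lia.
by apply: contraPneq xl => ->; rewrite lil => -[]; lia.
Qed.

Lemma min_away r : root_toward v la r ->
  exists q, [/\ min_label (~: (branch v r :|: [set li])) = q, 0 < q < n.+3, j <= P q &
    forall l, 0 < l < n.+3 -> j <= P l -> q <= l].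
Proof.
move=> rr; have [x0 [_ [xb _ _ Px _]]] := two_ex tP.
have x0l : x0 \in labels (~: (branch v r :|: [set li])).
  by rewrite (away_labels _ rr) xb Px.
have [mq mx] := min_label_spec x0l; eexists; split; first by [].
- by move: mq; rewrite (away_labels _ rr) => /andP [].
- by move: mq; rewrite (away_labels _ rr) => /andP [].
move=> l lb jl; have : l \in labels (~: (branch v r :|: [set li])).
  by rewrite (away_labels _ rr) lb.
by case/min_label_spec.
Qed.

Lemma root_toward_leaf r y q : lab y = Some q -> 0 < q < n.+3 -> j <= P q ->
  root_toward v q r =
  adj v r && (if P q == j then r == y else (lab r == None) && (pos r == j.+1)).
Proof.
move=> yq qb jq; rewrite (root_towardE L _ _ yq); case vr: (adj v r) => //=.
rewrite (branchE L y vl vr) (old_pos yq) ?vj; last by lia.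
move: (vr); case rl: (lab r) => [l|] /=.
  rewrite (adj_leaf L vl rl) vj => /eqP jr; case: ifP => Pj; first by rewrite eq_sym.
  by apply: contraFF Pj => /eqP yr; rewrite -(old_pos yq) ?yr -?jr //; lia.
rewrite (adj_spine L vl rl) vj => h.
have -> : (r == y) = false by apply: contraPF rl => /eqP ->; rewrite yq.
by case: (P q =P j); case: ifP; lia.
Qed.

End SlideStep.

Lemma least_label_at_0 n P q : trivalent_pos n P -> 0 < q ->
  (forall l, 0 < l < n.+3 -> q <= l) -> P q = 0.
Proof.
move=> tP q0 qm; have := qm 1 isT => q1; have -> : q = 1 by lia.
exact: (pos_b tP).
Qed.

(** Only the branch of [a] and that of the least remaining label [q] can move: [v] has
    four neighbours and must keep one besides the new leaf. If that second branch
    is the leaf [q], the step is a legal one. If it is the right part of the spine,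
    then the new vertex has three internal neighbours: [v] and its former
    neighbours to the left and to the right. *)
Lemma slide_layout (T T' : lgraph) n j P (pos : T -> nat) i :
  trivalent_pos n P -> layout n n.+4 (attach_pos n.+3 P j) pos -> num i = n.+3 ->
  slide i T T' -> (exists p : seq T', spine_path p) ->
  exists2 q, admissible n.+3 P j q &
    exists pos' : T' -> nat, layout n.+1 n.+4 (graft n.+3 P j q) pos'.
Proof.
move=> tP L ni [li [v [ra [rm [M [[lil liv] ta tm [Mn raM rmM] [st is']]]]]]] sp'.
rewrite ni in lil; have [vl vj] : lab v = None /\ pos v = j.
  move: liv; rewrite (adj_near L) lil (leaf_posE L lil) /attach_pos eqxx.
  by case: (lab v) => //= /eqP.
have jn : j <= n by rewrite -vj; apply: (pos_bound L).
have [q [mE qb jq qm]] := min_away tP L vl vj lil ta.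
have [yq yql] := leaf_ex L (l := q) ltac:(lia).
have ypos : pos yq = P q by rewrite (leaf_posE L yql) /attach_pos ifN //; lia.
rewrite mE (root_toward_leaf L vl vj _ yql qb jq) in tm.
move: ta; rewrite (root_toward_a tP L vl vj) => /andP [vra rA].
have Madj x : x \in M -> adj v x /\ x != li.
  by move/(subsetP Mn); rewrite !inE => /andP [].
have vM : v \notin M by apply/negP => /Madj []; rewrite (layout_irr L).
have [tree' ld' _ d2' _] := st.
have inM1 : exists2 t, adj v t & (t != li) && (t \notin M).
  case: (pickP [pred t | [&& adj v t, t != li & t \notin M]]) => [t|none].
    by case/and3P=> vt tli tM; exists t; rewrite ?tli.
  have liM : li \notin M by apply/negP => /Madj [_]; rewrite eqxx.
  case/eqP: (d2' (Some v : move_branches v M)); rewrite /degree.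
  have <- : #|[set (None : move_branches v M); Some li]| = 2 by rewrite cards2.
  apply: eq_card => -[x|]; rewrite !inE /= ?eqxx // -[Some x == Some li]/(x == li).
  have [->|xli] := eqVneq x li; first by rewrite (layout_sym L) liv (negbTE liM) (negbTE vM) !andbF.
  case vx: (adj v x) => //=; have := none x.
  by rewrite /= vx xli /= => /negbFE ->.
case: ifP tm => [/eqP Pq|/negbT Pq] /andP [vrm rmE].
  exists q; first by split.
  have [t vt /andP [tli tM]] := inM1.
  have movedE x : adj v x -> (x == ra) || (x == rm) = moved pos j q x.
    move=> vx; rewrite (eqP rmE) /moved; apply/idP/idP.
      case/orP => /eqP ->; last by rewrite yql eqxx.
      by case: (lab ra) rA => // k ->; rewrite orbT.
    case xl: (lab x) => [l|] xM.
      case/orP: xM => [/eqP lq|/andP [/eqP l0 /eqP j0]].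
        by rewrite orbC (_ : x = yq) ?eqxx //; apply: (leaf_inj L _ yql); rewrite xl lq.
      case ral: (lab ra) rA => [k|] /=; last by rewrite j0.
      case/andP=> /eqP k0 _; rewrite (_ : x = ra) ?eqxx //.
      by apply: (leaf_inj L _ ral); rewrite xl l0 k0.
    case ral: (lab ra) rA => [k|] /=; first by case/andP=> _ /eqP j0; rewrite j0 in xM.
    by move=> rp; rewrite (_ : x = ra) ?eqxx //; apply: (spine_inj L xl ral); lia.
  (* off the new leaf and the two roots that move, v has a single neighbour: it
     is t, so that M holds nothing but these two roots *)
  have rest x : adj v x -> x != li -> ~~ moved pos j q x ->
      (if lab x is Some l then [&& 0 < l < n.+3, l != q & P l == j] else pos x == j.+1).
    move=> vx xli; rewrite /moved; case xl: (lab x) => [l|].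
      move: vx; rewrite (adj_leaf L vl xl) vj => /eqP jx /norP [lq].
      have lb := leaf_bound L xl; rewrite lq /=.
      have lN : l != n.+3.
        by apply: contraNneq xli => lN; apply/eqP/(leaf_inj L _ lil); rewrite xl lN.
      have px : pos x = P l by rewrite (leaf_posE L xl) /attach_pos ifN.
      rewrite negb_and -px jx eqxx andbT => h; rewrite lt0n.
      have [l0|l0] := eqVneq l 0; last by move: lb lN l0; clear; lia.
      by move: h; rewrite px l0 (pos_a tP).
    by move: vx; rewrite (adj_spine L vl xl) vj; clear; lia.
  have tnm : ~~ moved pos j q t.
    rewrite -(movedE _ vt); apply: contra tM => /orP [] /eqP -> //.
  have ME x : (x \in M) = moved pos (pos v) q x.
    rewrite vj; apply/idP/idP => [xM|xm]; last first.
      have vx : adj v x.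
        move: xm; rewrite /moved (adj_near L) vl; case xl: (lab x) => [l|] /=;
          last by rewrite vj; clear; lia.
        case/orP => [/eqP lq|/andP [/eqP l0 /eqP j0]].
          by rewrite (_ : x = yq) ?ypos ?vj ?Pq //; apply: (leaf_inj L _ yql); rewrite xl lq.
        by rewrite vj j0 (leaf_posE L xl) l0 /attach_pos /= (pos_a tP).
      by move: xm; rewrite -(movedE _ vx) => /orP [] /eqP ->.
    have [vx xli] := Madj _ xM; apply/negPn/negP => xm.
    have rx := rest _ vx xli xm; have rt := rest _ vt tli tnm.
    suff xt : x = t by rewrite -xt xM in tM.
    have up l k : 0 < l < n.+3 -> l != q -> P l = j -> k <= n -> k <> j.+1.
      move=> lb lq Pl kn ek; case/eqP: lq; apply: (one_uniq tP) => //; rewrite ?Pl ?Pq //.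
      by move: kn ek; clear; lia.
    case xl: (lab x) rx => [l|] rx; case tl: (lab t) rt => [k|] rt.
    + case/and3P: rx rt => lb lq /eqP Pl /and3P [kb kq /eqP Pk].
      apply: (leaf_inj L xl); rewrite tl; congr Some.
      have [jlt|jge] := ltnP j n.
        by case/eqP: lq; apply: (one_uniq tP) => //; rewrite ?Pl ?Pq.
      have jn' : j = n by apply/eqP; rewrite eqn_leq jn.
      have := two_max tP lb kb qb; rewrite Pl Pk Pq => /(_ jn' jn' jn').
      by rewrite (negbTE lq) (negbTE kq) !orbF => /eqP.
    + case/and3P: rx => lb lq /eqP Pl.
      by case: (up _ _ lb lq Pl (pos_bound L t)); apply/eqP.
    + case/and3P: rt => lb lq /eqP Pl.
      by case: (up _ _ lb lq Pl (pos_bound L x)); apply/eqP.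
    + by apply: (spine_inj L xl tl); rewrite (eqP rx) (eqP rt).
  have qb' : 0 < q < n.+4 by move: qb; clear; lia.
  have qN : q != n.+3 by move: qb; clear; lia.
  have := move_layout L vl _ _ _ ME.
  rewrite {1}/attach_pos /= (pos_a tP) => /(_ erefl qb').
  rewrite {1}/attach_pos ifN ?vj //.
  by move=> /(_ Pq) L'; apply: iso_layout is' L'.
exfalso; case/andP: rmE => /eqP rml /eqP rmp.
have j0 : 0 < j.
  rewrite lt0n; apply: contra Pq => /eqP j0; rewrite (least_label_at_0 tP) ?j0 //.
    by case/andP: qb.
  by move=> l lb; apply: qm; rewrite ?j0.
have [ral rap] : lab ra = None /\ (pos ra).+1 = j.
  by case: (lab ra) rA => [k|] /=; [case/andP=> _; lia | move/eqP].
have [p sp] := iso_spine_path is' sp'.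
apply: (@spine_path_three (move_branches v M) p None (Some ra) (Some rm) (Some v) tree' sp) => //=.
- by rewrite raM orbT.
- by rewrite rmM orbT.
- by rewrite eqxx.
- by case=> e; move: rap; rewrite e rmp; lia.
- by case=> e; move: raM; rewrite e (negbTE vM).
- by case=> e; move: rmM; rewrite e (negbTE vM).
Qed.

Lemma slide_exists (T : lgraph) n j P (pos : T -> nat) q i :
  trivalent_pos n P -> layout n n.+4 (attach_pos n.+3 P j) pos -> num i = n.+3 ->
  j <= n -> admissible n.+3 P j q ->
  exists2 T' : lgraph, slide i T T' &
    exists pos' : T' -> nat, layout n.+1 n.+4 (graft n.+3 P j q) pos'.
Proof.
move=> tP L ni jn ad; have [qb Pq qm] := ad.
have [v vl vj] := spine_ex L jn.
have [li lil] := leaf_ex L (ltnSn n.+3).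
have lpos : pos li = j by rewrite (leaf_posE L lil) /attach_pos eqxx.
have [yq yql] := leaf_ex L (l := q) ltac:(lia).
have ypos : pos yq = j by rewrite (leaf_posE L yql) /attach_pos ifN //; lia.
pose M := [set x | moved pos j q x]; pose T' := move_branches v M.
have [ra vra rA] : exists2 ra, adj v ra &
    is_true (if lab ra is Some l then (l == 0) && (j == 0) else (pos ra).+1 == j).
  have [j0|j0] := posnP j.
    have [a al] := leaf_ex L (isT : 0 < n.+4); exists a; last by rewrite al.
    by rewrite (adj_leaf L vl al) vj (leaf_posE L al) /attach_pos (pos_a tP) j0.
  have [a al ap] := spine_ex L (k := j.-1) ltac:(lia); exists a; last by rewrite al; lia.
  by rewrite (adj_spine L vl al); lia.
have ta : root_toward v la ra.
  by rewrite (root_toward_a tP L vl vj) vra.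
have mq : min_label (~: (branch v ra :|: [set li])) = q.
  have [q' [-> qb' jq' qm']] := min_away tP L vl vj lil ta.
  have q'q : q' <= q by apply: qm'; rewrite ?Pq.
  have qq' : q <= q' by apply: qm.
  lia.
have L' : exists pos' : T' -> nat, layout n.+1 n.+4 (graft n.+3 P j q) pos'.
  have := @move_layout _ _ _ _ _ v M q L vl.
  rewrite {1}/attach_pos /= (pos_a tP) => /(_ erefl ltac:(lia)).
  rewrite {1}/attach_pos ifN ?vj; last by lia.
  by move=> /(_ Pq) L'; eexists; apply: L' => x; rewrite inE.
exists T' => //; exists li, v, ra, yq, M; split.
- by rewrite ni (layout_sym L) (adj_leaf L vl lil) vj lpos.
- exact: ta.
- rewrite mq (root_toward_leaf L vl vj _ yql) ?Pq // eqxx (adj_leaf L vl yql) vj ypos.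
  by rewrite !eqxx.
- split; last by rewrite inE /moved yql eqxx.
    apply/subsetP => x; rewrite !inE /moved => xm; apply/andP; split.
      apply: contraTneq xm => ->; rewrite lil; lia.
    rewrite (adj_near L) vl vj; case xl: (lab x) xm => [l|] /= xm; last by lia.
    case/orP: xm => [/eqP lq|/andP [/eqP l0 /eqP j0]].
      by rewrite (_ : pos x = j) // (leaf_posE L xl) lq -[RHS]ypos (leaf_posE L yql).
    by rewrite (leaf_posE L xl) l0 /attach_pos (pos_a tP) j0.
  by rewrite inE /moved; case: (lab ra) rA => // l ->; rewrite orbT.
split; last exact: iso_refl.
by have [pos' L2] := L'; apply: (layout_stable L2); apply: graft_trivalent.
Qed.

(** * The trees of Slide(1, ..., 1) that are caterpillars *)

Lemma slide_from_rcons i ks k (X : lgraph -> Prop) :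
  slide_from i (rcons ks k) X =
  iter k (slide_set (i + size ks)) (attach_set (i + size ks) (slide_from i ks X)).
Proof.
elim: ks i X => [|k' ks IH] i X /=; first by rewrite addn0.
by rewrite IH addSnnS.
Qed.

Lemma SlideOmega_ones n : SlideOmega (nseq n.+1 1) =
  slide_set n.+1 (attach_set n.+1 (SlideOmega (nseq n 1))).
Proof.
have -> : nseq n.+1 1 = rcons (nseq n 1) 1 by rewrite -cats1 -(addn1 n) nseqD.
by rewrite /SlideOmega slide_from_rcons size_nseq add1n.
Qed.

Lemma star_layout : layout 0 3 (fun=> 0) (fun _ : star_abc => 0).
Proof.
split=> //.
- by move=> [x|] [y|].
- by move=> [|k] // _; exists None.
- by move=> [x|] [y|].
- by move=> [x|] l //= [<-]; split.
- by move=> l l3; exists (Some (Ordinal l3)).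
- by move=> [x|] [y|] l //= [<-] [e]; congr Some; apply/val_inj.
Qed.

Lemma SlideOmega_stable n T : SlideOmega (nseq n.+1 1) T ->
  forall x : T, isSome (lab x) = (degree x == 1).
Proof.
rewrite SlideOmega_ones => -[T1 _ [li [v [ra [rm [M [_ _ _ _ [st is']]]]]]]].
by case: st => _ ld _ _ _; apply: iso_leaf_degree is' ld.
Qed.

Lemma SlideOmega_symmetric n T : SlideOmega (nseq n 1) T -> symmetric (@adj T).
Proof.
case: n => [|n] sT; first exact: iso_symmetric sT (layout_sym star_layout).
move: sT; rewrite SlideOmega_ones => -[T1 _ [li [v [ra [rm [M [_ _ _ _ [st is']]]]]]]].
by case: st => -[sU _ _ _] _ _ _ _; apply: iso_symmetric is' sU.
Qed.

Lemma attach_symmetric (T : lgraph) l (v : T) :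
  symmetric (@adj T) -> symmetric (@adj (attach_at l v)).
Proof. by move=> sT [x|] [y|] //=; apply: sT. Qed.

(** The tree before a step inherits the spine of the tree after it, so that only
    caterpillars have to be followed. *)
Lemma SlideOmega_layout n T : SlideOmega (nseq n 1) T ->
  (exists p : seq T, spine_path p) ->
  exists w P, grown n w P /\ exists pos : T -> nat, layout n n.+3 P pos.
Proof.
elim: n T => [|n IH] T sT pT.
  exists [::], (fun=> 0); split; first by constructor.
  exact: iso_layout sT star_layout.
move: sT; rewrite SlideOmega_ones => -[T1 [T0 s0 [u ui i1]] sl].
have nn : num n.+1 = n.+3 by rewrite /num addn2.
rewrite nn in i1.
have sym1 : symmetric (@adj T1).
  by apply: (iso_symmetric i1); apply: attach_symmetric; apply: SlideOmega_symmetric s0.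
have p1 : exists p : seq T1, spine_path p.
  case: (sl) => [li [v [ra [rm [M [[lil liv] _ _ [Mn _ _] [st is']]]]]]].
  have Mv x : x \in M -> adj v x by move/(subsetP Mn); rewrite !inE => /andP [].
  have [tU ld _ _ _] := st.
  have := iso_spine_path is' pT; apply: move_spine_path => //.
  have := ld (Some v : move_branches v M) => /=; case: (lab v) => // l /esym.
  have liM : li \notin M by apply/negP => /(subsetP Mn); rewrite !inE eqxx.
  rewrite /degree (cardD1 (None : move_branches v M)) (cardD1 (Some li : move_branches v M)).
  rewrite !inE /= eqxx sym1 liv (negbTE liM) andbF /=.
  have -> : (li == v) && (v \in M) = false.
    apply/negP => /andP [/eqP e vM]; move: liM; rewrite e vM //.
  by [].
have p0 : exists p : seq T0, spine_path p.
  exact: attach_spine_path (iso_spine_path i1 p1).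
have [w [P [g [pos L]]]] := IH _ s0 p0.
have tP := grown_trivalent g.
have ul : lab u = None by move: ui; rewrite (layout_internal L tP) => /eqP.
have [pos1 L1] := iso_layout i1 (attach_layout L ul).
have [q ad L2] := slide_layout tP L1 nn sl pT.
exists (insert_at (pos u) n.+1 w), (graft n.+3 P (pos u) q); split=> //.
by constructor => //; apply: (pos_bound L).
Qed.

Lemma layout_SlideOmega n w P : grown n w P ->
  exists2 T, SlideOmega (nseq n 1) T & exists pos : T -> nat, layout n n.+3 P pos.
Proof.
elim=> [|{w P}n w P j q g [T0 s0 [pos L]] jn ad].
  by exists star_abc; [exact: iso_refl | eexists; exact: star_layout].
have tP := grown_trivalent g; have nn : num n.+1 = n.+3 by rewrite /num addn2.
have [u ul uj] := spine_ex L jn.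
have L1 := attach_layout L ul; rewrite uj in L1.
have [T2 sl L2] := slide_exists tP L1 nn jn ad.
exists T2 => //; rewrite SlideOmega_ones; exists (attach_at n.+3 u) => //.
exists T0 => //; exists u; first by rewrite (layout_internal L tP) ul.
by rewrite nn; apply: iso_refl.
Qed.

(** * Contracting edges of a layout *)

Lemma count_take_S (a : pred nat) w k : k < size w ->
  count a (take k.+1 w) = count a (take k w) + a (nth 0 w k).
Proof. by move=> kw; rewrite (take_nth 0 kw) -cats1 count_cat /= addn0. Qed.

Lemma count_take_mono (a : pred nat) w i k : i <= k ->
  count a (take i w) <= count a (take k w).
Proof.
move=> ik; rewrite -(subnKC ik) takeD count_cat; exact: leq_addr.
Qed.

(** The number of letters satisfying [a] in the prefixes of [w] grows by steps of one,
    so it takes all values in between. *)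
Lemma count_take_jump (a : pred nat) w t : t < count a w ->
  exists k, [/\ k < size w, count a (take k w) = t & a (nth 0 w k)].
Proof.
elim/last_ind: w => // w x IH; rewrite -cats1 count_cat /= addn0 => tb.
have [tw|wt] := ltnP t (count a w).
  have [k [kw <- ak]] := IH tw; exists k; split.
  - by rewrite size_cat /=; lia.
  - by rewrite takel_cat // ltnW.
  - by rewrite nth_cat kw.
exists (size w); rewrite size_cat take_size_cat // nth_cat ltnn subnn /=.
by split; [lia | | case: (a x) tb]; lia.
Qed.

(** The edge between the positions [k] and [k.+1] is kept when the letter of index
    [k] of [w] satisfies [a], and contracted otherwise; contracting shifts a
    vertex to the number of kept edges on its left. *)
Section Contraction.
Variables (T : lgraph) (n N : nat) (P : nat -> nat) (pos : T -> nat).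
Hypothesis L : layout n N P pos.
Variables (a : pred nat) (w : seq nat) (F : {set {set T}}).
Hypothesis sw : size w = n.
Let c k := count a (take k w).
Hypothesis FP : forall x y : T, adj x y -> ([set x; y] \in F) =
  [&& lab x == None, lab y == None & ~~ a (nth 0 w (minn (pos x) (pos y)))].

Let R := connect [rel x y | adj x y && ([set x; y] \in F)].
(** Membership in the same class, in terms of the positions. *)
Let E (x y : T) := (x == y) || [&& lab x == None, lab y == None & c (pos x) == c (pos y)].

Let cS k : k < n -> c k.+1 = c k + a (nth 0 w k).
Proof. by rewrite -sw; apply: count_take_S. Qed.

Let cmono i k : i <= k -> c i <= c k.
Proof. exact: count_take_mono. Qed.

Let R_E x y : R x y = E x y.
Proof.
apply/idP/idP => [|/predU1P [->|]]; last 1 first.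
- case/and3P=> /eqP xl /eqP yl /eqP cc.
  have up d : forall u v : T, lab u = None -> lab v = None -> pos v = pos u + d ->
      c (pos u) = c (pos v) -> R u v.
    elim: d => [|d IH] u v ul vl uv cuv.
      by rewrite (spine_inj L ul vl) ?uv ?addn0 //; apply: connect0.
    have vn := pos_bound L v.
    have [z zl zp] := spine_ex L (k := (pos u).+1) ltac:(lia).
    have h1 := cmono (leqnSn (pos u)); have h2 := @cmono (pos u).+1 (pos v) ltac:(lia).
    apply: (connect_trans (y := z)); last by apply: IH => //; rewrite ?zp; lia.
    apply: connect1; have uz : adj u z by rewrite (adj_spine L ul zl) zp eqxx orbT.
    rewrite /= uz FP // ul zl /= zp (minn_idPl _) //.
    by have := @cS (pos u) ltac:(lia); case: (a _) => //; lia.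
  have Rsym : connect_sym [rel x y | adj x y && ([set x; y] \in F)].
    by apply: sym_connect_sym => u v /=; rewrite (layout_sym L) setUC.
  have [xy|yx] := leqP (pos x) (pos y).
    by apply: (up (pos y - pos x)) => //; lia.
  by rewrite /R Rsym; apply: (up (pos x - pos y)) => //; lia.
- move=> h; apply: (connect_inv _ h); last by rewrite /E eqxx.
  move=> y' z /andP [yz]; rewrite FP // => /and3P [yl zl aw].
  have cyz : c (pos y') = c (pos z).
    move: yz aw; rewrite (adj_spine L (eqP yl) (eqP zl)).
    have := pos_bound L y'; have := pos_bound L z.
    case/orP: (leq_total (pos y') (pos z)) => le zn yn yz.
      rewrite (minn_idPl le) => aw; have e : pos z = (pos y').+1 by lia.
      by rewrite e cS ?(negbTE aw); lia.
    rewrite (minn_idPr le) => aw; have e : pos y' = (pos z).+1 by lia.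
    by rewrite e cS ?(negbTE aw); lia.
  case/predU1P => [->|/and3P [xl _ /eqP xy]]; rewrite /E ?yl zl ?xl ?cyz ?eqxx ?orbT //.
  by rewrite xy cyz eqxx orbT.
- exact: connect0.
Qed.

Let R_eqv : {in [set: T] & &, equivalence_rel R}.
Proof.
move=> x y z _ _ _; split; first exact: connect0.
rewrite !R_E /E => /predU1P [->//|/and3P [xl yl /eqP cxy]].
rewrite xl yl cxy; case: (x =P z) => [xz|_]; case: (y =P z) => [yz|_] //=.
  by rewrite -xz xl cxy eqxx.
by rewrite -yz yl eqxx.
Qed.

Let parts := contraction_classes F.

Let partsP : partition parts [set: T].
Proof. exact: equivalence_partitionP R_eqv. Qed.

Let class_ex (A : contract F) : exists x, x \in val A.
Proof.
have [_ _ s0] := and3P partsP.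
by apply/set0Pn; apply: contraNneq s0 => <-; apply: (valP A).
Qed.

Let classE (A : contract F) x y : x \in val A -> (y \in val A) = E x y.
Proof.
move=> xA; have [_ tri _] := and3P partsP.
have <- : pblock parts x = val A by apply: (def_pblock tri) (valP A) xA.
by rewrite -R_E -(pblock_equivalence_partition R_eqv (in_setT x) (in_setT y)).
Qed.

Let class_of x : exists A : contract F, x \in val A.
Proof.
have [/eqP cov tri _] := and3P partsP; have xc : x \in cover parts by rewrite cov inE.
by exists (exist _ (pblock parts x) (pblock_mem xc)); rewrite /= mem_pblock.
Qed.

Let class_uniq (A B : contract F) x : x \in val A -> x \in val B -> A = B.
Proof.
move=> xA xB; have [_ tri _] := and3P partsP; apply: val_inj.
by rewrite -(def_pblock tri (valP A) xA) -(def_pblock tri (valP B) xB).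
Qed.

Let class_lab (A : contract F) x : x \in val A -> lab A = lab x.
Proof.
move=> xA; rewrite /=; case: pickP => [y /andP [yA]|none].
  by rewrite (classE y xA) in yA; case/predU1P: yA => [->//|/and3P [_ /eqP ->]].
by have := none x; rewrite xA /=; case: (lab x).
Qed.

(** All members of a class have the same new position; the value 0 is a default. *)
Definition contract_pos (A : contract F) : nat :=
  if [pick x in val A] is Some x then c (pos x) else 0.

Lemma contract_posE (A : contract F) x : x \in val A -> contract_pos A = c (pos x).
Proof.
move=> xA; rewrite /contract_pos; case: pickP => [y yA|/(_ x)]; last by rewrite xA.
by rewrite (classE y xA) in yA; case/predU1P: yA => [->//|/and3P [_ _ /eqP]].
Qed.

Lemma contract_layout : layout (c n) N (fun l => c (P l)) contract_pos.
Proof.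
have adjP (A B : contract F) : reflect (A <> B /\ exists x y : T,
    [/\ x \in val A, y \in val B & adj x y]) (adj A B).
  apply: (iffP andP) => [[/eqP AB /exists_inP [x xA /exists_inP [y yB xy]]]|].
    by split=> //; exists x, y.
  case=> AB [x [y [xA yB xy]]]; split; first exact/eqP.
  by apply/exists_inP; exists x => //; apply/exists_inP; exists y.
have adjC (A B : contract F) : adj A B = adj B A.
  by apply/adjP/adjP => -[AB [x [y [xA yB xy]]]]; split;
    [auto | exists y, x; rewrite (layout_sym L)| auto | exists y, x; rewrite (layout_sym L)].
have jump (A B : contract F) x y : x \in val A -> y \in val B ->
    lab x = None -> lab y = None -> c (pos y) = (c (pos x)).+1 -> adj A B.
  move=> xA yB xl yl cxy.
  have [|k [kn ck ak]] := @count_take_jump a w (c (pos x)).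
    by have := cmono (pos_bound L y); rewrite cxy /c -sw take_size.
  rewrite sw in kn.
  have [x' xl' xp'] := spine_ex L (ltnW kn); have [y' yl' yp'] := spine_ex L kn.
  apply/adjP; split.
    move=> AB; have := contract_posE xA; rewrite AB (contract_posE yB); lia.
  exists x', y'; split.
  - by rewrite (classE _ xA) /E xl xl' xp' -ck !eqxx orbT.
  - by rewrite (classE _ yB) /E yl yl' yp' cS // cxy -[c k]/(count _ _) ck ak addn1 !eqxx orbT.
  - by rewrite (adj_spine L xl' yl') xp' yp' !eqxx orbT.
have mixed (A B : contract F) x y l : x \in val A -> y \in val B ->
    lab x = Some l -> lab y = None -> adj A B = (c (pos x) == c (pos y)).
  move=> xA yB xl yl; apply/adjP/eqP => [[AB [x' [y' [xA' yB' xy]]]]|cxy].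
    rewrite (classE _ xA) /E xl orbF in xA'; rewrite -(eqP xA') in xy.
    rewrite (classE _ yB) in yB'; have yl' : lab y' = None.
      by case/predU1P: yB' => [<-//|/and3P [_ /eqP]].
    have cy : c (pos y') = c (pos y).
      by case/predU1P: yB' => [<-//|/and3P [_ _ /eqP]].
    by move: xy; rewrite (layout_sym L) (adj_leaf L yl' xl) => /eqP <-.
  split; first by move=> AB; have := class_lab xA; rewrite AB (class_lab yB) yl xl.
  have [z zl zp] := spine_ex L (pos_bound L x).
  exists x, z; split=> //; first by rewrite (classE _ yB) /E yl zl zp cxy !eqxx orbT.
  by rewrite (layout_sym L) (adj_leaf L zl xl) zp.
split.
- move=> A B; have [x xA] := class_ex A; have [y yB] := class_ex B.
  rewrite (class_lab xA) (class_lab yB) (contract_posE xA) (contract_posE yB).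
  case xl: (lab x) => [l|]; case yl: (lab y) => [k|]; rewrite [RHS]/=.
  + apply/adjP => -[AB [x' [y' [xA' yB']]]].
    rewrite (classE _ xA) /E xl orbF in xA'; rewrite (classE _ yB) /E yl orbF in yB'.
    by rewrite -(eqP xA') -(eqP yB') (adj_near L) xl yl.
  + exact: mixed xA yB xl yl.
  + by rewrite adjC (mixed _ _ _ _ _ yB xA yl xl) eq_sym.
  apply/idP/orP => [/adjP [AB [x' [y' [xA' yB' xy]]]]|[/eqP cxy|/eqP cxy]].
  + have cx : c (pos x') = c (pos x) by rewrite -(contract_posE xA) (contract_posE xA').
    have cy : c (pos y') = c (pos y) by rewrite -(contract_posE yB) (contract_posE yB').
    have nc : c (pos x) != c (pos y).
      apply/eqP => cxy; apply: AB; apply: (class_uniq (x := y)) => //.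
      by rewrite (classE _ xA) /E xl yl cxy !eqxx orbT.
    have xl' : lab x' = None by rewrite -(class_lab xA') (class_lab xA).
    have yl' : lab y' = None by rewrite -(class_lab yB') (class_lab yB).
    move: xy nc; rewrite (adj_spine L xl' yl') -cx -cy.
    have := pos_bound L x'; have := pos_bound L y' => yn xn.
    case/orP=> /eqP e; rewrite e in xn yn *; rewrite cS //; case: (a _) => /=; lia.
  + by rewrite adjC; apply: jump yB xA yl xl cxy.
  + exact: jump xA yB xl yl cxy.
- by move=> A; have [x xA] := class_ex A; rewrite (contract_posE xA) cmono // (pos_bound L).
- move=> k; rewrite leq_eqVlt => kc.
  have [i ni ci] : exists2 i, i <= n & c i = k.
    case/predU1P: kc => [->|]; first by exists n.
    rewrite {1}/c -{1}sw take_size => /count_take_jump [i [ib ci _]].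
    by exists i => //; rewrite -sw ltnW.
  have [x xl xp] := spine_ex L ni; have [A xA] := class_of x.
  by exists A; rewrite ?(class_lab xA) // (contract_posE xA) xp.
- move=> A B; have [x xA] := class_ex A; have [y yB] := class_ex B.
  rewrite (class_lab xA) (class_lab yB) (contract_posE xA) (contract_posE yB) => xl yl cxy.
  by apply: (class_uniq (x := y)) => //; rewrite (classE _ xA) /E xl yl cxy !eqxx orbT.
- move=> A l; have [x xA] := class_ex A; rewrite (class_lab xA) (contract_posE xA) => xl.
  by have [lN ->] := leaf_pos L xl.
- move=> l /(leaf_ex L) [x xl]; have [A xA] := class_of x.
  by exists A; rewrite (class_lab xA).
- move=> A B l; have [x xA] := class_ex A; have [y yB] := class_ex B.
  rewrite (class_lab xA) (class_lab yB) => xl yl.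
  by apply: (class_uniq (x := x)) => //; rewrite (leaf_inj L xl yl).
Qed.

Lemma contract_class x : exists A : contract F,
  [/\ x \in val A, lab A = lab x & contract_pos A = c (pos x)].
Proof.
by have [A xA] := class_of x; exists A; rewrite (class_lab xA) (contract_posE xA).
Qed.

Lemma contract_lab (A : contract F) x : x \in val A -> lab A = lab x.
Proof. exact: class_lab. Qed.

End Contraction.

(** * The slide labeling of a layout *)

(** The edge that receives the label [l]: in the contracted tree it joins the
    positions [j] and [j.+1], the latter being that of the leaf [num l]. *)
Section SlideEdge.
Variables (T : lgraph) (m N : nat) (P : nat -> nat) (pos : T -> nat).
Hypothesis L : layout m N P pos.
Variables (j q r l : nat).
Hypotheses (N0 : 0 < N) (P0 : P 0 = 0) (lN : num l < N) (Pl : P (num l) = j.+1).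
Implicit Types (v x y : T) (k : nat).

Let off v := \bigcup_(x | adj v x && (la \notin labels (branch v x))
                          && (num l \notin labels (branch v x))) branch v x.

Let offP v k y : lab y = Some k -> reflect (exists x, [/\ adj v x,
    la \notin labels (branch v x), num l \notin labels (branch v x) & y \in branch v x])
  (k \in labels (off v)).
Proof.
move=> yk; apply: (iffP (labelsP _ _)) => [[y' /bigcupP [x]]|[x [vx xa xl yx]]].
  move=> /andP [/andP [vx xa] xl] yx yk'; rewrite (leaf_inj L yk' yk) in yx.
  by exists x.
by exists y => //; apply/bigcupP; exists x => //; rewrite vx xa xl.
Qed.

Let in_branch v x k y : lab y = Some k -> (k \in labels (branch v x)) = (y \in branch v x).
Proof.
move=> yk; apply/labelsP/idP => [[z zb zk]|yb]; last by exists y.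
by rewrite -(leaf_inj L zk yk).
Qed.

Let off_labels v k : k \in labels (off v) -> k < N.
Proof. by case/labelsP => y _ yk; apply: (leaf_bound L yk). Qed.

(** Off [a] and off the leaf [num l], the vertex at [j.+1] sees what sits at its own
    position and further right. *)
Lemma off_right v k : lab v = None -> pos v = j.+1 -> k < N ->
  (k \in labels (off v)) = (j < P k) && (k != num l).
Proof.
move=> vl vj kN; have [y yk] := leaf_ex L kN; have [a al] := leaf_ex L N0.
have [z zl] := leaf_ex L lN.
have pa : pos a = 0 by rewrite (leaf_posE L al).
have pz : pos z = j.+1 by rewrite (leaf_posE L zl).
rewrite -(leaf_posE L yk); apply/(offP _ yk)/andP => [[x [vx]]|[jk kl]].
  rewrite (in_branch _ _ al) (in_branch _ _ zl).
  rewrite !(branchE L _ vl vx) vj pa pz ltnn /=.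
  move: vx; case xl: (lab x) => [h|] /= vx.
    move=> _ zx /eqP yx; move: vx; rewrite (adj_leaf L vl xl) vj -yx => /eqP <-.
    split=> //; apply: contraNneq zx => kl; apply/eqP.
    by apply: (leaf_inj L zl); rewrite -yx yk kl.
  move: vx; rewrite (adj_spine L vl xl) vj; case: ifP => //= xv vx _ _ yj.
  split; first by lia.
  by apply/eqP => kl; move: yj; rewrite (leaf_posE L yk) kl Pl ltnn.
have [jy|yj] := eqVneq (pos y) j.+1.
  exists y; have vy : adj v y by rewrite (adj_leaf L vl yk) vj jy.
  rewrite (in_branch _ _ al) (in_branch _ _ zl) !(branchE L _ vl vy) yk /= eqxx; split=> //.
    by apply: contraPneq jk => <-; rewrite pa.
  by apply: contraNneq kl => zy; move: yk; rewrite -zy zl => -[->].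
have [x xl xp] := spine_ex L (k := j.+2) ltac:(have := pos_bound L y; lia).
have vx : adj v x by rewrite (adj_spine L vl xl) xp vj eqxx orbT.
exists x; rewrite (in_branch _ _ al) (in_branch _ _ zl) !(branchE L _ vl vx) xl /= xp vj pa pz.
by rewrite !ifN; try lia; split=> //; lia.
Qed.

(** The vertex at [j] only sees the leaves hanging from it: [a] is to its left and the
    leaf [num l] to its right. *)
Lemma off_left v k : lab v = None -> pos v = j -> k < N ->
  (k \in labels (off v)) = (P k == j) && (k != 0).
Proof.
move=> vl vj kN; have [y yk] := leaf_ex L kN; have [a al] := leaf_ex L N0.
have [z zl] := leaf_ex L lN.
have pa : pos a = 0 by rewrite (leaf_posE L al).
have pz : pos z = j.+1 by rewrite (leaf_posE L zl).
rewrite -(leaf_posE L yk); apply/(offP _ yk)/andP => [[x [vx]]|[/eqP yj k0]].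
  rewrite (in_branch _ _ al) (in_branch _ _ zl).
  rewrite !(branchE L _ vl vx) vj pa pz /=.
  move: vx; case xl: (lab x) => [h|] /= vx; last first.
    by move: vx; rewrite (adj_spine L vl xl) vj; case: ifP; lia.
  move=> ax _ /eqP yx; move: vx; rewrite (adj_leaf L vl xl) vj -yx => /eqP <-.
  split=> //; apply: contraNneq ax => k0; apply/eqP.
  by apply: (leaf_inj L al); rewrite -yx yk k0.
have vy : adj v y by rewrite (adj_leaf L vl yk) vj yj.
exists y; rewrite (in_branch _ _ al) (in_branch _ _ zl) !(branchE L _ vl vy) yk /= eqxx.
split=> //; last by apply: contraPneq pz => ->; rewrite yj; lia.
by apply: contraNneq k0 => ay; move: yk; rewrite -ay al => -[<-].
Qed.

Lemma slide_edge_intro v vb : admissible N P j q -> 0 < r < num l -> j < P r ->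
  lab v = None -> pos v = j.+1 -> lab vb = None -> pos vb = j -> slide_edge l v vb.
Proof.
move=> [qb Pq qm] rb jr vl vj vbl vbj.
have [a al] := leaf_ex L N0; have [z zl] := leaf_ex L lN.
have pa : pos a = 0 by rewrite (leaf_posE L al).
have vvb : adj v vb by rewrite (adj_spine L vl vbl) vj vbj eqxx.
have minvb : min_off (num l) vb = q.
  apply: min_labelE => [|k kX].
    by rewrite (off_left vbl vbj) ?Pq ?eqxx //=; lia.
  have kN := off_labels kX; move: kX; rewrite (off_left vbl vbj) // => /andP [/eqP kj k0].
  by apply: qm; [rewrite lt0n k0 | rewrite kj].
have rX : r \in labels (off v) by rewrite (off_right vl vj) ?jr; lia.
have [mX mr] := min_label_spec rX.
have mN := off_labels mX; rewrite (off_right vl vj mN) in mX.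
apply/and5P; split.
- by rewrite (at_leafE L vl zl) vj (leaf_posE L zl) Pl.
- by rewrite (root_towardE L _ _ al) vvb (branchE L _ vl vvb) vbl /= vj vbj pa ltnSn.
- by rewrite vbl.
- by apply: leq_ltn_trans mr _; case/andP: rb.
rewrite minvb -/(off v) /min_off; set k := min_label _ in mX mN *.
have qk : q <= k by apply: qm; case: k mX mN => [|k] //; rewrite ?P0 //=; lia.
rewrite ltn_neqAle qk andbT; apply: contraTneq mX => <-; rewrite Pq ltnn //.
Qed.

Lemma slide_edge_elim v vb : slide_edge l v vb ->
  [/\ lab v = None, pos v = j.+1, lab vb = None & pos vb = j].
Proof.
have [a al] := leaf_ex L N0; have [z zl] := leaf_ex L lN.
have pa : pos a = 0 by rewrite (leaf_posE L al).
have pz : pos z = j.+1 by rewrite (leaf_posE L zl).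
case/and5P => lv tv vba _ _.
have [vl vj] : lab v = None /\ pos v = j.+1.
  case/existsP: lv => x /andP [/eqP xl xv]; rewrite (leaf_inj L xl zl) in xv.
  by move: xv; rewrite (adj_near L) zl pz; case: (lab v) => //= /eqP.
move: tv; rewrite (root_towardE L _ _ al) => /andP [vvb].
rewrite (branchE L _ vl vvb) vj pa; case vbl: (lab vb) vba => [k|] /=.
  by move=> h /eqP avb; move: h; rewrite -vbl -avb al eqxx.
by move: vvb; rewrite (adj_spine L vl vbl) vj; case: ifP; split=> //; lia.
Qed.

End SlideEdge.

Section Labeling.
Variables (T : lgraph) (n : nat) (w : seq nat) (P : nat -> nat) (pos : T -> nat).
Hypotheses (g : grown n w P) (L : layout n n.+3 P pos).
Variable S : nat -> T.
Hypothesis SP : forall k, k <= n -> lab (S k) = None /\ pos (S k) = k.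

Definition spine_edge (k : nat) : {set T} := [set S k; S k.+1].

(** The state of the slide labeling once the labels above [l] have been placed. *)
Definition labeled_above (l : nat) (lam : {set T} -> nat) : Prop :=
  (forall k, k < n -> lam (spine_edge k) = if l < nth 0 w k then nth 0 w k else 0) /\
  (forall X, lam X != 0 -> exists2 k, k < n & X = spine_edge k).

Let sw : size w = n. Proof. exact: (grown_size g). Qed.

Lemma spine_edge_adj x y : lab x = None -> lab y = None -> adj x y ->
  minn (pos x) (pos y) < n /\ [set x; y] = spine_edge (minn (pos x) (pos y)).
Proof.
move=> xl yl; rewrite (adj_spine L xl yl); have xn := pos_bound L x.
have yn := pos_bound L y => xy; split; first by lia.
have ex : x = S (pos x) by apply: (spine_funE L SP).
have ey : y = S (pos y) by apply: (spine_funE L SP).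
case/orP: xy => /eqP e; last by rewrite e (minn_idPl (leqnSn _)) /spine_edge -e -ex -ey.
by rewrite e (minn_idPr (leqnSn _)) /spine_edge -e -ex -ey setUC.
Qed.

Lemma spine_edge_inj i k : i < n -> k < n -> spine_edge i = spine_edge k -> i = k.
Proof.
move=> ib kb e.
have [_ pi] := SP (ltnW ib); have [_ pi1] := SP ib.
have [_ pk] := SP (ltnW kb); have [_ pk1] := SP kb.
have : S i \in spine_edge k by rewrite -e !inE eqxx.
have : S i.+1 \in spine_edge k by rewrite -e !inE eqxx orbT.
rewrite !inE => /orP [] /eqP e1 /orP [] /eqP e2; move: pi pi1; rewrite e1 e2; lia.
Qed.

(** In the tree where the edges above [l] are contracted the conditions of the slide
    labeling single out two adjacent positions ([grown_stage]); the only edge of the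
    layout which joins these two is the one with letter [l]. *)
Lemma label_step_above l lam : 0 < l <= n -> labeled_above l lam ->
  labeled_above l.-1 (@label_step T l lam).
Proof.
move=> lb [lamE lam0].
pose a := leq^~ l; pose F := [set e | lam e != 0].
have FP x y : adj x y -> ([set x; y] \in F) =
    [&& lab x == None, lab y == None & ~~ a (nth 0 w (minn (pos x) (pos y)))].
  move=> xy; rewrite inE; case xl: (lab x) => [h|] /=.
    apply/negbTE/negP => /lam0 [k kn e].
    have : x \in spine_edge k by rewrite -e !inE eqxx.
    by have [l1 _] := SP (ltnW kn); have [l2 _] := SP kn;
      rewrite !inE => /orP [] /eqP ex; rewrite ex ?l1 ?l2 in xl.
  case yl: (lab y) => [h|] /=.
    apply/negbTE/negP => /lam0 [k kn e].
    have : y \in spine_edge k by rewrite -e !inE eqxx orbT.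
    by have [l1 _] := SP (ltnW kn); have [l2 _] := SP kn;
      rewrite !inE => /orP [] /eqP ex; rewrite ex ?l1 ?l2 in yl.
  have [kn ->] := spine_edge_adj xl yl xy; rewrite lamE // /a -ltnNge.
  by case: ifP => //; lia.
have L' := contract_layout L sw FP.
set c := fun k => count a (take k w).
have [[q ad] [Pl [r [rb jr]]]] := grown_stage g lb.
set K := index l w in ad Pl jr; set j := count _ _ in ad Pl jr.
have lw : l \in w by rewrite (perm_mem_le _ (grown_perm g)).
have Kn : K < n by rewrite -sw index_mem.
have wK : nth 0 w K = l by rewrite nth_index.
have cK : c K = j by [].
have cS k : k < n -> c k.+1 = c k + a (nth 0 w k).
  by move=> kn; apply: count_take_S; rewrite sw.
have cmono i k : i <= k -> c i <= c k by apply: count_take_mono.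
have lN : num l < n.+3 by rewrite /num; lia.
have P0 : c (P 0) = 0 by rewrite (pos_a (grown_trivalent g)) /c take0.
have slideP (A B : contract F) : slide_edge l A B <->
    [/\ lab A = None, contract_pos pos a w A = j.+1, lab B = None & contract_pos pos a w B = j].
  split=> [|[Al Aj Bl Bj]].
    exact: (slide_edge_elim L' (ltn0Sn _) P0 lN Pl).
  exact: (slide_edge_intro L' (ltn0Sn _) P0 lN Pl ad rb jr).
have edgeP (x y : T) (A B : contract F) : adj x y -> slide_edge l A B -> x \in val A ->
    y \in val B -> [set x; y] = spine_edge K.
  move=> xy /slideP [Al Aj Bl Bj] xA yB.
  have xl : lab x = None by rewrite -(contract_lab L sw FP xA).
  have yl : lab y = None by rewrite -(contract_lab L sw FP yB).
  have cx : c (pos x) = j.+1 by rewrite -Aj (contract_posE L sw FP xA).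
  have cy : c (pos y) = j by rewrite -Bj (contract_posE L sw FP yB).
  have [kn ->] := spine_edge_adj xl yl xy; congr spine_edge.
  have px : pos x = (pos y).+1.
    move: xy; rewrite (adj_spine L xl yl) => /orP [/eqP //|/eqP e].
    by have := @cmono (pos x) (pos y); rewrite cx cy e => /(_ (leqnSn _)); lia.
  rewrite px (minn_idPr (leqnSn _)) in kn *.
  apply/eqP; rewrite eqn_leq; apply/andP; split; rewrite leqNgt; apply/negP => lt.
    by have := cmono _ _ lt; rewrite cS // cK cy wK /a leqnn; lia.
  by have := cmono _ _ lt; rewrite -px cx cK; lia.
have [x [y [A [B [xy AB xA yB]]]]] : exists x y (A B : contract F),
    [/\ adj x y, slide_edge l A B, x \in val A & y \in val B].
  have [l1 p1] := SP Kn; have [l0 p0] := SP (ltnW Kn).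
  have [A [xA Al Ac]] := contract_class L sw FP (S K.+1).
  have [B [yB Bl Bc]] := contract_class L sw FP (S K).
  exists (S K.+1), (S K), A, B; split=> //.
    by rewrite (adj_spine L l1 l0) p1 p0 eqxx.
  apply/slideP; rewrite Al Bl Ac Bc p1 p0; split=> //.
  by rewrite -[count _ _]/(c K.+1) cS // cK wK /a leqnn addn1.
have stepE X : @label_step T l lam X = if X == spine_edge K then l else lam X.
  rewrite /label_step -/F; case: pickP => [[u v] /=|none].
    case/andP=> uv /existsP [A' /existsP [B' /and3P [AB' uA vB]]].
    by rewrite (edgeP _ _ _ _ uv AB' uA vB).
  have := none (x, y); rewrite /= xy /=.
  move/negbT/negP; case; apply/existsP; exists A; apply/existsP; exists B.
  by rewrite AB xA yB.
split=> [k kn|X]; rewrite stepE.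
  have [e|ek] := eqVneq (spine_edge k) (spine_edge K).
    by rewrite (spine_edge_inj kn Kn e) wK ifT //; lia.
  rewrite lamE //; have nl : nth 0 w k != l.
    apply: contraNneq ek => e; apply/eqP; congr spine_edge.
    apply/eqP; rewrite -(nth_uniq 0 _ _ (_ : uniq w)) ?sw // ?e ?wK //.
    by rewrite (perm_uniq (grown_perm g)) iota_uniq.
  by do 2! case: ifP; lia.
case: (X =P spine_edge K) => [-> _|_]; first by exists K.
exact: lam0.
Qed.

Lemma slide_labelingE k : k < n -> slide_labeling n (spine_edge k) = nth 0 w k.
Proof.
have main d l : l + d = n ->
    labeled_above l (foldr (@label_step T) (fun=> 0) (iota l.+1 d)).
  elim: d l => [|d IH] l ld; last first.
    rewrite /=; have := @label_step_above l.+1 _ ltac:(lia) (IH l.+1 ltac:(lia)).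
    exact.
  split=> // i ib; have /andP [_ wn] := perm_nth (grown_perm g) ib.
  by rewrite ifN //; lia.
have [lamE _] := main n 0 (add0n n); move=> kn.
rewrite /slide_labeling lamE //.
by have := perm_nth (grown_perm g) kn; case: ifP; lia.
Qed.

Lemma wordE : word n T = w.
Proof.
rewrite /word (spineE L (grown_trivalent g) SP) /=.
apply: (@eq_from_nth _ 0); rewrite size_pairmap size_map size_iota ?sw // => i ib.
rewrite (nth_pairmap (S 0)) ?size_map ?size_iota //.
rewrite -[S 0 :: _]/(map S (iota 0 n.+1)) !(nth_map 0) ?size_iota //; last by lia.
by rewrite !nth_iota ?add0n ?add1n; [exact: slide_labelingE|lia|lia].
Qed.

End Labeling.

(** * The words of the caterpillars *)

Lemma grown_word n w P (T : lgraph) (pos : T -> nat) :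
  grown n w P -> layout n n.+3 P pos -> word n T = w.
Proof. by move=> g L; have [S SP] := spine_fun L; exact: (wordE g L SP). Qed.

Lemma Cat_layout n (T : lgraph) : 0 < n -> Cat n T -> exists P,
  grown n (word n T) P /\ exists pos : T -> nat, layout n n.+3 P pos.
Proof.
case: n => // n _ [sT _ cT].
have pT := caterpillar_spine_path (SlideOmega_stable sT) cT.
have [w [P [g [pos L]]]] := SlideOmega_layout sT pT.
by exists P; rewrite (grown_word g L); split=> //; exists pos.
Qed.

Theorem proposition6p2 (n : nat) (hn : 1 <= n) :
  (forall w : seq nat,
     (exists2 T : lgraph, Cat n T & word n T = w) <->
     (perm_eq w (iota 1 n) /\ avoids_23_1 w)) /\
  (forall T1 T2 : lgraph,
     Cat n T1 -> Cat n T2 -> word n T1 = word n T2 -> iso T1 T2).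
Proof.
split=> [w|T1 T2 /(Cat_layout hn) [P1 [g1 [pos1 L1]]] /(Cat_layout hn) [P2 [g2 [pos2 L2]]] e].
  split=> [[T /(Cat_layout hn) [P [g _]] <-]|[pw av]].
    by split; [exact: (grown_perm g) | exact: (grown_avoids g)].
  have [P g] := avoids_grown pw av.
  have [T sT [pos L]] := layout_SlideOmega g; have tP := grown_trivalent g.
  exists T; last exact: (grown_word g L).
  have [S SP] := spine_fun L.
  by split; [| exact: (layout_trivalent L tP) | exact: (layout_caterpillar L tP SP)].
rewrite e in g1; apply: (layout_unique L1).
apply: eq_layout L2 => l lb; exact: esym (grown_uniq g1 g2 lb).
Qed.
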